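(* Let $(M,c)$ be a Riemannian conformal structure on a manifold $M$ of dimension $n\ge 2$. For every choice of a metric $g\in c$ and an admissible smooth $1$-parameter family $\alpha\colon\mathbb{R}\to\mathcal{T}_{(1,1)}M$ (with $\alpha(\rho)$ nonsingular for $|\rho|<\delta$), the manifold $\widetilde M=\mathbb{R}^+\times(-\delta,\delta)\times M$, with coordinates $(t,\rho)$ on the first two factors, endowed with the metric $$\widetilde g=d(\rho t)\otimes dt+dt\otimes d(\rho t)+t^2\,g(\alpha(\rho)(-),-),$$ the free $\mathbb{R}^+$-action $\widetilde\varphi(\tau,(t,\rho,x))=(\tau t,\rho,x)$ and the embedding $\iota_g\colon\mathcal{Q}\to\widetilde M$, $t^2g_x\mapsto(t,0,x)$, of the scale bundle $\mathcal{Q}$ of $(M,c)$, is a pre-ambient space for $(M,c)$.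
   Context: Manifolds are smooth, Hausdorff, second countable, without boundary. A Riemannian conformal structure $(M,c)$ is an equivalence class $c$ of Riemannian metrics on $M$, where $g\sim g'$ iff $g'=e^{2u}g$ for some $u\in C^\infty(M)$. $\mathcal{T}_{(1,1)}M$ denotes the endomorphism fields of $TM$. Scale bundle. $\pi\colon\mathcal{Q}\to M$ is the ray bundle whose fiber over $x$ consists of the values $g_x$ of all metrics $g\in c$; it is a principal $\mathbb{R}^+$-bundle for the action $\varphi(\tau,g_x)=\tau^2g_x$. $Z_{\mathcal{Q}}$ denotes the fundamental vector field, $Z_{\mathcal{Q}}(g_x)=\frac{d}{ds}\big|_{s=0}\varphi(e^s,g_x)$. Pre-ambient space. A pre-ambient space for $(M,c)$ is an $(n+2)$-dimensional Lorentzian manifold $(\widetilde M,\widetilde g)$ (signature $(1,n+1)$) such that: (1) there are a free $\mathbb{R}^+$-action $\widetilde\varphi$ on $\widetilde M$ and an embedding $\iota\colon\mathcal{Q}\to\widetilde M$ with $\iota\circ\varphi=\widetilde\varphi\circ(\mathrm{id}_{\mathbb{R}^+}\times\iota)$ (so the fundamental vector field $Z\in\mathfrak{X}(\widetilde M)$ of $\widetilde\varphi$ is $\iota$-related to $Z_{\mathcal{Q}}$); (2) $\mathcal{L}_Z\widetilde g=2\widetilde g$, with $\mathcal{L}$ the Lie derivative; (3) for all $g_x\in\mathcal{Q}$ and $\xi,\eta\in T_{g_x}\mathcal{Q}$, $\iota^*(\widetilde g)_{g_x}(\xi,\eta)=g_x(T_{g_x}\pi\cdot\xi,T_{g_x}\pi\cdot\eta)$.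 Admissible family. A smooth $1$-parameter family $\alpha\colon\mathbb{R}\to\mathcal{T}_{(1,1)}M$ is admissible if each $\alpha(\rho)$ is self-adjoint with respect to any $g\in c$, $\alpha(0)=\mathrm{Id}$, and there is $\delta>0$ such that $\alpha(\rho)$ is nonsingular for $|\rho|<\delta$. *)

(* Defs.v *)
From HB Require Import structures.
From mathcomp Require Import all_boot all_order all_algebra.
From mathcomp Require Import all_classical all_reals all_analysis.

Set Implicit Arguments.
Unset Strict Implicit.
Unset Printing Implicit Defensive.

Import Order.TTheory GRing.Theory Num.Theory.
Import numFieldNormedType.Exports.

Local Open Scope classical_set_scope.
Local Open Scope ring_scope.

Section SmoothMaps.
Context {R : realType} {V W : normedModType R}.
Implicit Types (U : set V) (f : V -> W).

(* Only meant for U open and V finite dimensional; then f is C^(k+1) iff it is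
   differentiable and all its directional derivatives are C^k. *)
Fixpoint Ck (k : nat) U f : Prop :=
  match k with
  | 0%N => forall x, U x -> {for x, continuous f}
  | k'.+1 => (forall x, U x -> differentiable f x) /\
             (forall v, Ck k' U (fun x => 'D_v f x))
  end.

Definition smooth_on U f : Prop := forall k, Ck k U f.

Lemma smooth_on_addcst U f (a : W) :
  smooth_on U f -> smooth_on U (fun x => f x + a).
Proof.
move=> sf k; case: k (sf k) => [fC x Ux|k [fD sdf]].
  by apply: cvgD; [exact: fC|exact: cvg_cst].
split=> [x Ux|v].
  by apply: differentiableD; [exact: fD|exact: differentiable_cst].
suff -> : (fun x => 'D_v (fun x => f x + a) x) = fun x => 'D_v f x by exact: sdf.
apply/funext => x; rewrite /derive; set F := (F in lim (F @ _) = _).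
by have -> // : F = fun h => h^-1 *: (f (h *: v + x) - f x);
  apply/funext => h; rewrite /F /= opprD addrACA subrr addr0.
Qed.

End SmoothMaps.

(* A chart is given by its domain, the coordinate map, and its inverse; the two
   maps are total functions, meaningful only on cdom and on chart_img. *)
Record chart (R : realType) (T : topologicalType) (n : nat) := Chart {
  cdom : set T;
  cmap : T -> 'rV[R]_n;
  cinv : 'rV[R]_n -> T }.

Definition chart_img R T n (phi : @chart R T n) : set 'rV[R]_n :=
  cmap phi @` cdom phi.

Record charted_space (R : realType) (n : nat) := ChartedSpace {
  points :> topologicalType;
  atlas : set (chart R points n);
  chart_at : points -> chart R points n }.

Definition is_manifold R n (X : charted_space R n) : Prop :=
  [/\ hausdorff_space X,
      @second_countable X,
      (forall x : X, atlas (chart_at x) /\ cdom (chart_at x) x),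
      (forall phi : chart R X n, atlas phi ->
         [/\ open (cdom phi), open (chart_img phi),
             (forall x, cdom phi x -> cinv phi (cmap phi x) = x),
             (forall x, cdom phi x -> {for x, continuous (cmap phi)}) &
             (forall y, chart_img phi y -> {for y, continuous (cinv phi)})]) &
      (forall phi psi : chart R X n, atlas phi -> atlas psi ->
         smooth_on (cmap phi @` (cdom phi `&` cdom psi))
                   (cmap psi \o cinv phi))].

Definition smooth_fun R n (X : charted_space R n) (u : X -> R) : Prop :=
  forall phi : chart R X n, atlas phi ->
    smooth_on (chart_img phi) (u \o cinv phi).

Definition smooth_map R m n (X : charted_space R m) (Y : charted_space R n)
    (f : X -> Y) : Prop :=
  continuous f /\
  forall (phi : chart R X m) (psi : chart R Y n), atlas phi -> atlas psi ->
    smooth_on (cmap phi @` (cdom phi `&` f @^-1` cdom psi))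
              (cmap psi \o f \o cinv phi).

(* The tangent space of X at x is 'rV[R]_n: a tangent vector at x is given by
   its coordinates in the chart chart_at x.  The two maps below change between
   these coordinates and those in an arbitrary chart phi around x, where in
   from_chart the base point x is cinv phi y. *)
Section TangentSpaces.
Context {R : realType}.

Definition to_chart n (X : charted_space R n) (phi : chart R X n) (x : X) :
    'rV[R]_n -> 'rV[R]_n :=
  'd (cmap phi \o cinv (chart_at x)) (cmap (chart_at x) x).

Definition from_chart n (X : charted_space R n) (phi : chart R X n)
    (y : 'rV[R]_n) : 'rV[R]_n -> 'rV[R]_n :=
  'd (cmap (chart_at (cinv phi y)) \o cinv phi) y.

Definition tangent_map m n (X : charted_space R m) (Y : charted_space R n)
    (f : X -> Y) (x : X) : 'rV[R]_m -> 'rV[R]_n :=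
  'd (cmap (chart_at (f x)) \o f \o cinv (chart_at x)) (cmap (chart_at x) x).

Definition dfun n (X : charted_space R n) (f : X -> R) (x : X) :
    'rV[R]_n -> R :=
  'd (f \o cinv (chart_at x)) (cmap (chart_at x) x).

Definition smooth_embedding m n (X : charted_space R m) (Y : charted_space R n)
    (f : X -> Y) : Prop :=
  [/\ smooth_map f,
      (forall x, injective (tangent_map f x)),
      injective f &
      (forall A : set X, open A -> exists2 B : set Y, open B & A = f @^-1` B)].

End TangentSpaces.

Section Fields.
Context {R : realType} {n : nat} (X : charted_space R n).

Definition vector_field := X -> 'rV[R]_n.
Definition tensor02 := X -> 'rV[R]_n -> 'rV[R]_n -> R.
Definition endo_field := X -> 'rV[R]_n -> 'rV[R]_n.

(* Coordinate expressions in a chart phi, as functions of y = phi(x). *)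
Definition vector_rep (Z : vector_field) (phi : chart R X n) (y : 'rV[R]_n) :
    'rV[R]_n :=
  to_chart phi (cinv phi y) (Z (cinv phi y)).

Definition tensor_rep (T : tensor02) (phi : chart R X n) (u v y : 'rV[R]_n) :
    R :=
  T (cinv phi y) (from_chart phi y u) (from_chart phi y v).

Definition endo_rep (A : endo_field) (phi : chart R X n) (u y : 'rV[R]_n) :
    'rV[R]_n :=
  to_chart phi (cinv phi y) (A (cinv phi y) (from_chart phi y u)).

Definition smooth_symmetric_tensor (T : tensor02) : Prop :=
  [/\ (forall x, bilinear_for *%R *%R (T x)),
      (forall x u v, T x u v = T x v u) &
      (forall phi : chart R X n, atlas phi -> forall u v,
         smooth_on (chart_img phi) (tensor_rep T phi u v))].

Definition is_riemannian (g : tensor02) : Prop :=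
  smooth_symmetric_tensor g /\ forall x v, v != 0 -> 0 < g x v v.

(* (L_Z T)_ab = Z^c d_c T_ab + T_cb d_a Z^c + T_ac d_b Z^c, evaluated at x in
   the coordinates of chart_at x. *)
Definition lie_derivative (Z : vector_field) (T : tensor02) : tensor02 :=
  fun x u v =>
    let phi := chart_at x in
    let y := cmap phi x in
    'D_(vector_rep Z phi y) (tensor_rep T phi u v) y
    + tensor_rep T phi ('D_u (vector_rep Z phi) y) v y
    + tensor_rep T phi u ('D_v (vector_rep Z phi) y) y.

Definition smooth_endo_family (A : R -> endo_field) : Prop :=
  (forall rho x, linear (A rho x)) /\
  (forall phi : chart R X n, atlas phi -> forall u,
     smooth_on [set w : 'rV[R]_(1 + n) | chart_img phi (rsubmx w)]
       (fun w => endo_rep (A (lsubmx w 0 0)) phi u (rsubmx w))).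

Definition nonsingular (A : endo_field) : Prop := forall x, bijective (A x).

End Fields.

(* p negative and q positive squares *)
Definition has_signature (R : realType) (p q : nat)
    (h : 'rV[R]_(p + q) -> 'rV[R]_(p + q) -> R) : Prop :=
  exists2 B : 'M[R]_(p + q), B \in unitmx &
    forall i j, h (row i B) (row j B) =
      if i == j then (if (i < p)%N then -1 else 1) else 0.

Definition is_lorentzian (R : realType) (m : nat) (X : charted_space R (1 + m))
    (g : tensor02 X) : Prop :=
  smooth_symmetric_tensor g /\ forall x, has_signature (g x).

Section Products.
Context {R : realType}.

Definition prod_chart (S T : topologicalType) m n
    (phi : chart R S m) (psi : chart R T n) : chart R (S * T)%type (m + n) :=
  Chart [set p | cdom phi p.1 /\ cdom psi p.2]
        (fun p => row_mx (cmap phi p.1) (cmap psi p.2))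
        (fun w => (cinv phi (lsubmx w), cinv psi (rsubmx w))).

Definition prod_space m n (X : charted_space R m) (Y : charted_space R n) :
    charted_space R (m + n) :=
  @ChartedSpace R (m + n) (X * Y)%type
    [set chi | exists phi psi,
       [/\ atlas phi, atlas psi & chi = prod_chart phi psi]]
    (fun p => prod_chart (chart_at p.1) (chart_at p.2)).

(* Global coordinate on a subset A of the line; the charts differ only in the
   value a of the inverse map outside A. *)
Definition line_chart (A : set R) (a : A) : chart R A 1 :=
  Chart setT (fun t : A => (val t)%:M) (fun w => insubd a (w 0 0)).

Definition line_space (A : set R) : charted_space R 1 :=
  @ChartedSpace R 1 A (range (@line_chart A)) (@line_chart A).

End Products.

Section PositiveReals.
Context {R : realType}.

Definition posR : charted_space R 1 := line_space `]0, +oo[%classic.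

Fact mkpos_subproof (t : R) : 0 < t -> t \in `]0, +oo[%classic.
Proof. by move=> t0; rewrite inE /= in_itv /= andbT. Qed.

Definition mkpos (t : R) (t0 : 0 < t) : posR :=
  exist _ t (mkpos_subproof t0).

Lemma pos_gt0 (t : posR) : 0 < val t.
Proof. by have := valP t; rewrite inE /= in_itv /= andbT. Qed.

Definition pos1 : posR := mkpos ltr01.
Definition posM (s t : posR) : posR := mkpos (mulr_gt0 (pos_gt0 s) (pos_gt0 t)).
Definition posexp (s : R) : posR := mkpos (expR_gt0 s).

Definition smooth_free_action n (X : charted_space R n) (act : posR -> X -> X) :
    Prop :=
  [/\ (forall p, act pos1 p = p),
      (forall s t p, act (posM s t) p = act s (act t p)),
      (forall t p, act t p = p -> t = pos1) &
      @smooth_map _ _ _ (prod_space posR X) X (fun p => act p.1 p.2)].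

Definition fundamental_field n (X : charted_space R n) (act : posR -> X -> X) :
    vector_field X :=
  fun p => derive1 (fun s : R => cmap (chart_at p) (act (posexp s) p)) 0.

End PositiveReals.

Section ConformalStructures.
Context {R : realType} {n : nat} (M : charted_space R n).

Definition conformal_class (g : tensor02 M) : set (tensor02 M) :=
  [set g' | exists2 u : M -> R, smooth_fun u &
     g' = fun x v w => expR (2 * u x) * g x v w].

Record conformal_structure := ConformalStructure {
  metrics : set (tensor02 M);
  metrics_class :
    exists2 g, is_riemannian g & metrics = conformal_class g }.

Variable c : conformal_structure.

Lemma metrics_rescale g (t : R) : metrics c g -> 0 < t ->
  metrics c (fun x v w => t ^+ 2 * g x v w).
Proof.
case: c => m [g0 _ /= ->] [u u_smooth ->] t0.
exists (fun x => u x + ln t).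
  by move=> phi /u_smooth; exact: smooth_on_addcst.
apply/funext => x; apply/funext => v; apply/funext => w.
by rewrite mulrDr expRD (expRM_natl 2 (ln t)) lnK ?posrE //
  mulrA (mulrC (t ^+ 2)).
Qed.

Lemma metrics_ratio g g' : metrics c g -> metrics c g' -> forall x,
  exists t : posR, g' x = fun v w => val t ^+ 2 * g x v w.
Proof.
case: c => m [g0 _ /= ->] [u _ ->] [u' _ ->] x.
exists (posexp (u' x - u x)); apply/funext => v; apply/funext => w /=.
by rewrite -expRM_natl mulrBr mulrA -expRD subrK.
Qed.

(* A point of Q is a pair (x, g_x) with g in c. *)
Record scale_bundle := ScalePoint {
  foot : M;
  sform : 'rV[R]_n -> 'rV[R]_n -> R;
  sformP : exists2 g, metrics c g & sform = g foot }.

HB.instance Definition _ := gen_eqMixin scale_bundle.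
HB.instance Definition _ := gen_choiceMixin scale_bundle.

Fact scale_act_subproof (tau : posR) (q : scale_bundle) :
  exists2 g, metrics c g &
    (fun v w => val tau ^+ 2 * sform q v w) = g (foot q).
Proof.
case: q => x h [g cg hE] /=; rewrite hE.
by exists (fun x v w => val tau ^+ 2 * g x v w) => //;
  apply: metrics_rescale => //; exact: pos_gt0.
Qed.

Definition scale_act (tau : posR) (q : scale_bundle) : scale_bundle :=
  ScalePoint (scale_act_subproof tau q).

(* A metric g in c trivializes Q: q = t^2 g_x corresponds to (t, x).  The
   default value pos1 is irrelevant, see ray_coordP. *)
Definition ray_coord (g : tensor02 M) (q : scale_bundle) : posR :=
  xget pos1
    [set t : posR | sform q = fun v w => val t ^+ 2 * g (foot q) v w].

Lemma ray_coordP g q : metrics c g ->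
  sform q = fun v w => val (ray_coord g q) ^+ 2 * g (foot q) v w.
Proof.
move=> cg; rewrite /ray_coord; case: xgetP => [t _ //|no_t].
case: (sformP q) => g' cg' qE; have [t tE] := metrics_ratio cg cg' (foot q).
by case: (no_t t); rewrite /= qE.
Qed.

Definition trivialization (g : tensor02 M) (q : scale_bundle) :
    prod_space posR M :=
  (ray_coord g q, foot q).

(* The topology of Q makes every trivialization continuous. *)
HB.instance Definition _ := isSubBaseTopological.Build scale_bundle
  [set A : set scale_bundle | exists g (B : set (prod_space posR M)),
     [/\ metrics c g, open B & A = trivialization g @^-1` B]] id.

(* Chart (t^2 g_x) |-> (t, phi(x)); q0 is the value of the inverse map outside
   the image of the chart. *)
Definition scale_chart (g : tensor02 M) (phi : chart R M n)
    (q0 : scale_bundle) : chart R scale_bundle (1 + n) :=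
  Chart (foot @^-1` cdom phi)
        (fun q => row_mx (val (ray_coord g q))%:M (cmap phi (foot q)))
        (fun w => xget q0 [set q | foot q = cinv phi (rsubmx w) /\
           sform q = fun u v => lsubmx w 0 0 ^+ 2 * g (foot q) u v]).

Definition scale_space : charted_space R (1 + n) :=
  @ChartedSpace R (1 + n) scale_bundle
    [set chi | exists g phi q0,
       [/\ metrics c g, atlas phi & chi = scale_chart g phi q0]]
    (fun q => scale_chart (projT1 (cid2 (sformP q))) (chart_at (foot q)) q).

Definition is_preambient_space (X : charted_space R (1 + n.+1))
    (gt : tensor02 X) (act : posR -> X -> X) (iota : scale_space -> X) : Prop :=
  [/\ is_manifold X /\ is_lorentzian gt,
      smooth_free_action act,
      smooth_embedding iota /\
        (forall tau q, iota (scale_act tau q) = act tau (iota q)),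
      (forall p u v,
         lie_derivative (fundamental_field act) gt p u v = 2 * gt p u v) &
      (forall (q : scale_space) xi eta,
         gt (iota q) (tangent_map iota q xi) (tangent_map iota q eta) =
         sform q (@tangent_map _ _ _ scale_space M foot q xi)
                 (@tangent_map _ _ _ scale_space M foot q eta))].

Definition is_admissible (alpha : R -> endo_field M) : Prop :=
  [/\ smooth_endo_family alpha,
      (forall g, metrics c g -> forall rho x u v,
         g x (alpha rho x u) v = g x u (alpha rho x v)),
      (forall x u, alpha 0 x u = u) &
      (exists2 delta : R, 0 < delta &
         forall rho, `|rho| < delta -> nonsingular (alpha rho))].

End ConformalStructures.

Arguments is_preambient_space {R n M} c {X} gt act iota.

Section Ambient.
Context {R : realType} {n : nat} {M : charted_space R n}.
Context (c : conformal_structure M).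
Variable delta : R.

Definition ambient_space : charted_space R (1 + (1 + n)) :=
  prod_space posR (prod_space (line_space `]- delta, delta[%classic) M).

Definition ambient_t (p : ambient_space) : R := val p.1.
Definition ambient_rho (p : ambient_space) : R := val p.2.1.
Definition ambient_pr (p : ambient_space) : M := p.2.2.

(* d(rho t) (x) dt + dt (x) d(rho t) + t^2 g(alpha(rho) -, -) *)
Definition ambient_metric (g : tensor02 M) (alpha : R -> endo_field M) :
    tensor02 ambient_space :=
  fun p u v =>
    let dt := dfun ambient_t p in
    let drt := dfun (fun q => ambient_rho q * ambient_t q) p in
    let dpr := tangent_map ambient_pr p in
    drt u * dt v + dt u * drt v
    + ambient_t p ^+ 2 *
      g (ambient_pr p) (alpha (ambient_rho p) (ambient_pr p) (dpr u)) (dpr v).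

Definition ambient_act (tau : posR) (p : ambient_space) : ambient_space :=
  (posM tau p.1, p.2).

Fact rho0_subproof : 0 < delta -> 0 \in `]- delta, delta[%classic.
Proof. by move=> d0; rewrite inE /= in_itv /= oppr_lt0 d0. Qed.

Definition ambient_embedding (d0 : 0 < delta) (g : tensor02 M)
    (q : scale_space c) : ambient_space :=
  (ray_coord g q, (exist _ 0 (rho0_subproof d0), foot q)).

End Ambient.

Arguments ambient_metric {R n M} delta g alpha.
Arguments ambient_act {R n M} delta tau p.

(* Main.v *)
(* In coordinates (t, rho, x) the metric is the orthogonal sum of the plane
   2 rho dt^2 + 2 t dt drho, which is Lorentzian, and of t^2 g(alpha(rho) -, -).
   The latter is positive definite: alpha is self-adjoint, nonsingular for
   |rho| < delta and the identity at 0, so the forms g(alpha(s rho) -, -) with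
   0 <= s <= 1 cannot leave the positive cone without degenerating.  The action
   t -> tau t multiplies both summands by tau^2, which gives the Lie derivative.
   The metric g trivializes Q, and any other metric of c is exp(2u) g, so in any
   chart of Q the embedding reads (t, y) |-> (t exp(u), 0, y); as rho = 0 and
   alpha(0) = Id on its image, the pullback of the metric is t^2 g. *)

Require Import Defs.
From HB Require Import structures.
From mathcomp Require Import all_boot all_order all_algebra.
From mathcomp Require Import all_classical all_reals all_analysis.
From mathcomp Require Import ring.
Import Order.TTheory GRing.Theory Num.Theory.
Import numFieldNormedType.Exports.
Local Open Scope classical_set_scope.
Local Open Scope ring_scope.

Set Implicit Arguments.
Unset Strict Implicit.
Unset Printing Implicit Defensive.

(** * Smooth maps between normed modules *)

Section DiffNear.
Context {R : realType} {V W : normedModType R}.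

(** Tangent vectors at [x] are coordinates in [chart_at x], and chart inverses are total functions
    meaningful only on the chart image. Hence one pattern recurs: pass to a chart, replace the map
    by an explicit formula valid near the point, and transfer the derivative by locality. These
    formulas only combine linear maps, sums, products, [expR] and given smooth maps precomposed with
    linear projections, so no general chain rule for [Ck] is required. The given metric [g] cannot
    be used throughout: [chart_at] on Q picks some metric of the class by choice, and the topology
    of Q comes from the trivializations of all metrics. The resulting factor exp(u) gives the
    t-component of the embedding a derivative along M; it does not reach the pullback, because d(rho
    t) = rho dt + t drho vanishes on the image. Only its derivative along the fibres of Q matters,
    for injectivity. The Lie derivative is defined by its coordinate formula, so homogeneity enters
    infinitesimally: along the field t d/dt the metric coefficients are quadratic polynomials. *)

Lemma is_diff_near0 (h : V -> W) (x : V) :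
  (\forall y \near x, h y = 0) -> is_diff x h (cst 0).
Proof.
move=> h0; have hx0 := nbhs_singleton h0.
have E : h \o shift x = cst (h x) + cst 0 +o_ 0 id.
  apply/eqaddoP => e e0.
  have : \forall y \near 0, (h \o shift x) y = 0.
    by rewrite (near_shift x 0); near do rewrite /= sub0r addrNK.
  apply: filterS => y hy.
  have -> : (h \o shift x - (cst (h x) + cst 0)) y
            = (h \o shift x) y - (h x + 0) by [].
  by rewrite hy hx0 addr0 subr0 normr0 mulr_ge0 // ltW.
have d0 : 'd h x = cst 0 :> (V -> W).
  apply: (@diff_unique _ _ _ h \0%R) => //; exact: cst_continuous.
apply: DiffDef => //; apply/diff_locallyP; rewrite d0; split => //.
exact: cst_continuous.
Unshelve. all: by end_near. Qed.

(** The difference [g - f] vanishes near [x], so it has derivative zero there. Since [is_diff]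
    carries both differentiability and the derivative, both are transferred at once from a formula
    valid only locally. *)
Lemma is_diff_near_eq (f g df : V -> W) (x : V) :
  (\forall y \near x, f y = g y) -> is_diff x f df -> is_diff x g df.
Proof.
move=> fg dfx.
have gfx : is_diff x (g - f) (cst 0).
  apply: is_diff_near0; apply: filterS fg => y fgy.
  by rewrite -[LHS]/(g y - f y) fgy subrr.
have -> : g = (g - f) + f by rewrite subrK.
have -> : df = (cst 0) + df by apply/funext => y;
  rewrite -[RHS]/(0 + df y) add0r.
exact: is_diffD.
Qed.

Lemma is_diff_linear (f : {linear V -> W}) (x : V) :
  continuous f -> is_diff x f f.
Proof.
move=> cf; apply: DiffDef; first exact: linear_differentiable.
exact: diff_lin.
Qed.

Lemma is_diff_derive (f df : V -> W) (x v : V) :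
  is_diff x f df -> 'D_v f x = df v.
Proof. by case=> fd <-; rewrite deriveE. Qed.

End DiffNear.

Lemma linear_rV_continuous {R : realType} {W : normedModType R} (n : nat)
  (f : {linear 'rV[R]_n -> W}) : continuous f.
Proof.
have -> : (f : _ -> _) = fun v => \sum_i v 0 i *: f (delta_mx 0 i).
  by apply/funext => v; rewrite [in LHS](row_sum_delta v) linear_sum;
    apply: eq_bigr => i _; rewrite linearZ.
have fC i : continuous (fun v : 'rV[R]_n => v 0 i *: f (delta_mx 0 i)).
  by move=> v; apply: (@cvgZr_tmp _ _ _ (nbhs v)); exact: coord_continuous.
elim: (index_enum _) => [|i s IH] v.
  by under eq_fun do rewrite big_nil; exact: cst_continuous.
by under eq_fun do rewrite big_cons; exact: continuousD (fC i v) (IH v).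
Qed.

(** * Closure properties of [Ck] *)

Section CkCalculus.
Context {R : realType}.
Implicit Types V W : normedModType R.

(** Openness turns equality on [U] into equality near each of its points, which is all that limits
    and derivatives see. The closure lemmas use it to replace a derivative by a formula that holds
    on [U] only. *)
Lemma Ck_ext V W k (U : set V) (f g : V -> W) : open U ->
  (forall x, U x -> f x = g x) -> Ck k U f -> Ck k U g.
Proof.
move=> oU; elim: k f g => [|k IH] f g fg /=.
  move=> fC x Ux; rewrite /prop_for /continuous_at -(fg x Ux).
  apply: cvg_trans (fC x Ux); apply: near_eq_cvg.
  by apply: filterS (open_nbhs_nbhs (conj oU Ux)).
have fgn x : U x -> \forall y \near x, f y = g y.
  by move=> Ux; apply: filterS (open_nbhs_nbhs (conj oU Ux)).
case=> fd fC; split=> [x Ux|v].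
  by have /differentiableP/(is_diff_near_eq (fgn x Ux)) [] := fd x Ux.
apply: IH (fC v) => x Ux; apply: near_eq_derive; exact: fgn.
Qed.

Lemma Ck_sub V W k (U U' : set V) (f : V -> W) : U' `<=` U ->
  Ck k U f -> Ck k U' f.
Proof.
move=> UU'; elim: k f => [|k IH] f /=; first by move=> fC x /UU'; exact: fC.
by case=> fd fC; split=> [x /UU'|v]; [exact: fd|exact: IH].
Qed.

Lemma CkW V W k (U : set V) (f : V -> W) : Ck k.+1 U f -> Ck k U f.
Proof.
elim: k f => [|k IH] f; first by case=> fd _ x Ux;
  apply/differentiable_continuous/fd.
by case=> fd fC; split=> [//|v]; apply: IH; exact: fC.
Qed.

Lemma Ck_cst V W k (U : set V) (a : W) : Ck k U (cst a).
Proof.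
elim: k a => [|k IH] a /=; first by move=> x _; exact: cst_continuous.
split=> [x _|v]; first exact: differentiable_cst.
suff -> : (fun x : V => 'D_v (cst a : V -> W) x) = cst 0 by exact: IH.
by apply/funext => x; rewrite derive_cst.
Qed.

Lemma Ck_add V W k (U : set V) (f g : V -> W) : open U ->
  Ck k U f -> Ck k U g -> Ck k U (fun x => f x + g x).
Proof.
move=> oU; elim: k f g => [|k IH] f g /=.
  by move=> fC gC x Ux; apply: cvgD; [exact: fC|exact: gC].
case=> fd fC [gd gC]; split=> [x Ux|v].
  by apply: differentiableD; [exact: fd|exact: gd].
apply: (Ck_ext oU _ (IH _ _ (fC v) (gC v))) => x Ux.
by rewrite -[in RHS]/(f + g) deriveD //; apply: diff_derivable;
  [exact: fd|exact: gd].
Qed.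

Lemma Ck_linear_comp V W W' k (U : set V) (f : V -> W) (L : {linear W -> W'}) :
  continuous L -> open U -> Ck k U f -> Ck k U (fun x => L (f x)).
Proof.
move=> cL oU; elim: k f => [|k IH] f /=.
  move=> fC x Ux; apply: continuous_comp; [exact: fC|exact: cL].
case=> fd fC; split=> [x Ux|v].
  apply: (@differentiable_comp _ _ _ _ f L); first exact: fd.
  exact: linear_differentiable.
apply: (Ck_ext oU _ (IH _ (fC v))) => x Ux.
rewrite (deriveE v (fd x Ux)) deriveE.
  rewrite (@diff_comp _ _ _ _ f L) ?diff_lin //; first exact: fd.
  exact: linear_differentiable.
apply: (@differentiable_comp _ _ _ _ f L); first exact: fd.
exact: linear_differentiable.
Qed.

(** The difference quotient of the composite at [x] along [v] is that of [f] at [L x] along [L v],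
    so the two derivatives coincide at every point and the induction goes on with ['D_(L v) f]. *)
Lemma Ck_comp_linear V V' W k (U : set V) (f : V -> W) (L : {linear V' -> V}) :
  continuous L -> Ck k U f -> Ck k (L @^-1` U) (fun x => f (L x)).
Proof.
move=> cL; elim: k f => [|k IH] f /=.
  move=> fC x Ux; apply: continuous_comp; [exact: cL|exact: fC].
case=> fd fC; split=> [x Ux|v].
  apply: (@differentiable_comp _ _ _ _ L f); last exact: fd.
  exact: linear_differentiable.
suff -> : (fun x => 'D_v (fun y => f (L y)) x) = fun x => 'D_(L v) f (L x).
  exact: (IH _ (fC (L v))).
apply/funext => x; rewrite /derive; apply: (congr1 (fun F => lim (F @ 0^'))).
by apply/funext => h /=; rewrite linearP.
Qed.

Lemma Ck_linear V W k (U : set V) (L : {linear V -> W}) :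
  continuous L -> Ck k U L.
Proof.
move=> cL; case: k => [|k] /=; first by move=> x _; exact: cL.
split=> [x Ux|v]; first exact: linear_differentiable.
suff -> : (fun x => 'D_v L x) = cst (L v) by exact: Ck_cst.
by apply/funext => x; rewrite (is_diff_derive _ (is_diff_linear x cL)).
Qed.

Lemma Ck_mul V k (U : set V) (f g : V -> R) : open U ->
  Ck k U f -> Ck k U g -> Ck k U (fun x => f x * g x).
Proof.
move=> oU; elim: k f g => [|k IH] f g.
  by move=> fC gC x Ux; apply: cvgM; [exact: fC|exact: gC].
(* Leibniz's rule leaves one factor undifferentiated, so [f] and [g] themselves are needed at order
   [k] as well. *)
move=> fk gk; have fk' := CkW fk; have gk' := CkW gk.
case: fk gk => fd fC [gd gC]; split=> [x Ux|v].
  by apply: (@differentiableM _ _ f g); [exact: fd|exact: gd].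
apply: (Ck_ext oU _ (Ck_add oU (IH _ _ fk' (gC v)) (IH _ _ gk' (fC v)))).
move=> x Ux; rewrite -[in RHS]/(f * g) deriveM //; apply: diff_derivable;
  [exact: fd|exact: gd].
Qed.

Lemma Ck_expR V k (U : set V) (f : V -> R) : open U ->
  Ck k U f -> Ck k U (fun x => expR (f x)).
Proof.
move=> oU; elim: k f => [|k IH] f.
  by move=> fC x Ux; apply: continuous_comp; [exact: fC|exact: continuous_expR].
(* The derivative is ['D_v f] times the same exponential, whose order [k] comes from the induction
   hypothesis. *)
move=> fk; have fk' := IH _ (CkW fk).
have ed y : differentiable expR y by apply/derivable1_diffP/derivable_expR.
case: fk => fd fC; split=> [x Ux|v].
  by apply: (@differentiable_comp _ _ _ _ f expR); [exact: fd|].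
apply: (Ck_ext oU _ (Ck_mul oU (fC v) fk')) => x Ux.
rewrite [RHS]deriveE; last by apply: (@differentiable_comp _ _ _ _ f expR);
  [exact: fd|].
rewrite (@diff_comp _ _ _ _ f expR) //=; last exact: fd.
rewrite (deriveE v (fd x Ux)).
rewrite -[in RHS](mulr1 ('d f x v)) [RHS]linearZ /=; congr (_ * _).
by rewrite -deriveE // derive_val.
Qed.

Lemma Ck_sum V W k (U : set V) (I : finType) (F : I -> V -> W) : open U ->
  (forall i, Ck k U (F i)) -> Ck k U (fun x => \sum_i F i x).
Proof.
move=> oU FC; elim: (index_enum I) => [|i s IH].
  by under eq_fun do rewrite big_nil; exact: Ck_cst.
by under eq_fun do rewrite big_cons; exact: Ck_add.
Qed.

End CkCalculus.

Section RowVectors.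
Context {R : realType}.
Implicit Types V W : normedModType R.

(** Coordinate functions will come as bare functions with a proof of [linear]; here and in the
    variants below the bundled structure is built inside the proof. *)
Lemma is_diff_rV_linear W n (L : 'rV[R]_n -> W) (x : 'rV[R]_n) :
  linear L -> is_diff x L L.
Proof.
move=> linL; pose Lm := GRing.isLinear.Build _ _ _ _ _ linL.
pose L' : {linear 'rV[R]_n -> W} := HB.pack L Lm.
exact: (@is_diff_linear _ _ _ L' x (@linear_rV_continuous _ _ _ L')).
Qed.

Lemma rV_linear_continuous W n (L : 'rV[R]_n -> W) : linear L -> continuous L.
Proof.
by move=> linL x; apply: differentiable_continuous;
  have [] := is_diff_rV_linear x linL.
Qed.

Lemma Ck_rV_linear W n k (U : set 'rV[R]_n) (L : 'rV[R]_n -> W) :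
  linear L -> Ck k U L.
Proof.
move=> linL; pose Lm := GRing.isLinear.Build _ _ _ _ _ linL.
pose L' : {linear 'rV[R]_n -> W} := HB.pack L Lm.
exact: (Ck_linear k U (@linear_rV_continuous _ _ _ L')).
Qed.

Lemma Ck_rV_linear_comp V W n k (U : set V) (f : V -> 'rV[R]_n)
  (L : 'rV[R]_n -> W) :
  linear L -> open U -> Ck k U f -> Ck k U (fun x => L (f x)).
Proof.
move=> linL; pose Lm := GRing.isLinear.Build _ _ _ _ _ linL.
pose L' : {linear 'rV[R]_n -> W} := HB.pack L Lm.
exact: (Ck_linear_comp (@linear_rV_continuous _ _ _ L')).
Qed.

Lemma Ck_comp_rV_linear V W n k (U : set V) (f : V -> W)
  (L : 'rV[R]_n -> V) :
  linear L -> Ck k U f -> Ck k (L @^-1` U) (fun x => f (L x)).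
Proof.
move=> linL; pose Lm := GRing.isLinear.Build _ _ _ _ _ linL.
pose L' : {linear 'rV[R]_n -> V} := HB.pack L Lm.
exact: (Ck_comp_linear (@linear_rV_continuous _ _ _ L')).
Qed.

Lemma linear_coord m n i j : linear (fun v : 'M[R]_(m, n) => v i j : R).
Proof. by move=> a u v; rewrite !mxE. Qed.

Lemma linear_row_mxl m n : linear (fun v : 'rV[R]_m => row_mx v (0 : 'rV[R]_n)).
Proof. by move=> a u v; rewrite scale_row_mx add_row_mx scaler0 addr0. Qed.

Lemma linear_row_mxr m n : linear (fun v : 'rV[R]_n => row_mx (0 : 'rV[R]_m) v).
Proof. by move=> a u v; rewrite scale_row_mx add_row_mx scaler0 addr0. Qed.

Lemma row_mxDlr m n (u : 'rV[R]_m) (v : 'rV[R]_n) :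
  row_mx u v = row_mx u 0 + row_mx 0 v.
Proof. by rewrite add_row_mx addr0 add0r. Qed.

Lemma Ck_coord V n k (U : set V) (f : V -> 'rV[R]_n) i : open U ->
  Ck k U f -> Ck k U (fun x => f x 0 i).
Proof. by move=> oU; apply: (Ck_rV_linear_comp (linear_coord 0 i)). Qed.

Lemma Ck_row_mx V m n k (U : set V) (f : V -> 'rV[R]_m) (g : V -> 'rV[R]_n) :
  open U -> Ck k U f -> Ck k U g -> Ck k U (fun x => row_mx (f x) (g x)).
Proof.
move=> oU fC gC; under eq_fun do rewrite row_mxDlr; apply: Ck_add => //.
  exact: (Ck_rV_linear_comp (@linear_row_mxl _ _)).
exact: (Ck_rV_linear_comp (@linear_row_mxr _ _)).
Qed.

Lemma Ck_scalar_mx V k (U : set V) (f : V -> R) : open U ->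
  Ck k U f -> Ck k U (fun x => (f x)%:M : 'rV[R]_1).
Proof.
move=> oU fC.
have linL : linear (fun a : R => a%:M : 'rV[R]_1).
  by move=> a u v; rewrite raddfD /= scale_scalar_mx.
pose Lm := GRing.isLinear.Build _ _ _ _ _ linL.
pose L : {linear R -> 'rV[R]_1} := HB.pack (fun a : R => a%:M : 'rV[R]_1) Lm.
apply: (@Ck_linear_comp _ _ _ _ k U f L) => //.
have -> : (L : R -> 'rV[R]_1) = fun a => a *: 1%:M.
  by apply/funext => a; rewrite scalemx1.
exact: scalel_continuous.
Qed.

Lemma is_diff_row_mx V m n (f df : V -> 'rV[R]_m) (g dg : V -> 'rV[R]_n) x :
  is_diff x f df -> is_diff x g dg ->
  is_diff x (fun y => row_mx (f y) (g y)) (fun y => row_mx (df y) (dg y)).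
Proof.
move=> fD gD.
have -> : (fun y => row_mx (f y) (g y)) =
    ((fun v : 'rV[R]_m => row_mx v (0 : 'rV[R]_n)) \o f)
    + ((fun v : 'rV[R]_n => row_mx (0 : 'rV[R]_m) v) \o g).
  by apply/funext => y; rewrite row_mxDlr.
have -> : (fun y => row_mx (df y) (dg y)) =
    ((fun v : 'rV[R]_m => row_mx v (0 : 'rV[R]_n)) \o df)
    + ((fun v : 'rV[R]_n => row_mx (0 : 'rV[R]_m) v) \o dg).
  by apply/funext => y; rewrite row_mxDlr.
apply: is_diffD; apply: is_diff_comp; apply: is_diff_rV_linear.
  exact: linear_row_mxl.
exact: linear_row_mxr.
Qed.

Lemma is_diff_comp_linear V W n (f df : V -> W) (L : 'rV[R]_n -> V) x :
  linear L -> is_diff (L x) f df -> is_diff x (f \o L) (df \o L).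
Proof. by move=> linL fD; have := is_diff_rV_linear x linL => LD;
  apply: is_diff_comp. Qed.

End RowVectors.

(** * Charts and tangent spaces *)

Section Charts.
Context {R : realType} {n : nat} (X : charted_space R n).
Hypothesis HX : is_manifold X.

Lemma manifold_chart_atP x : atlas (chart_at x : chart R X n) /\
  cdom (chart_at x) x.
Proof. by have [_ _ + _ _] := HX; exact. Qed.

Lemma chart_cinvP (phi : chart R X n) y : atlas phi -> chart_img phi y ->
  cdom phi (cinv phi y) /\ cmap phi (cinv phi y) = y.
Proof.
move=> aphi [x Dx <-]; have [_ _ _ /(_ _ aphi)[_ _ K _ _] _] := HX.
by rewrite K.
Qed.

Lemma chart_cmapK (phi : chart R X n) x : atlas phi -> cdom phi x ->
  cinv phi (cmap phi x) = x.
Proof. by move=> aphi; have [_ _ _ /(_ _ aphi)[_ _ K _ _] _] := HX;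
  exact: K. Qed.

Lemma open_cdom (phi : chart R X n) : atlas phi -> open (cdom phi).
Proof. by move=> aphi; have [_ _ _ /(_ _ aphi)[]] := HX. Qed.

Lemma open_chart_img (phi : chart R X n) : atlas phi -> open (chart_img phi).
Proof. by move=> aphi; have [_ _ _ /(_ _ aphi)[]] := HX. Qed.

Lemma cmap_continuous (phi : chart R X n) x : atlas phi -> cdom phi x ->
  {for x, continuous (cmap phi)}.
Proof. by move=> aphi; have [_ _ _ /(_ _ aphi)[_ _ _ + _] _] := HX; exact. Qed.

Lemma cinv_continuous (phi : chart R X n) y : atlas phi -> chart_img phi y ->
  {for y, continuous (cinv phi)}.
Proof. by move=> aphi; have [_ _ _ /(_ _ aphi)[_ _ _ _ +] _] := HX; exact. Qed.

Lemma near_chart_img (phi : chart R X n) y : atlas phi -> chart_img phi y ->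
  \forall z \near y, chart_img phi z.
Proof. by move=> aphi iy; apply: open_nbhs_nbhs; split=> //;
  exact: open_chart_img. Qed.

Lemma near_cdom (phi : chart R X n) x : atlas phi -> cdom phi x ->
  \forall z \near x, cdom phi z.
Proof. by move=> aphi iy; apply: open_nbhs_nbhs; split=> //;
  exact: open_cdom. Qed.

(** Rewriting the image as a condition on [cinv phi y] reduces its openness to the continuity of
    [cinv phi]. *)
Lemma chart_imgI (phi : chart R X n) (B : set X) : atlas phi ->
  cmap phi @` (cdom phi `&` B) = [set y | chart_img phi y /\ B (cinv phi y)].
Proof.
move=> aphi; apply/seteqP; split=> [_ [x [Dx Bx] <-]|y [iy By]] /=.
  by split; [exists x|rewrite chart_cmapK].
by have [Dy Ky] := chart_cinvP aphi iy; exists (cinv phi y).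
Qed.

Lemma open_chart_imgI (phi : chart R X n) (B : set X) : atlas phi -> open B ->
  open (cmap phi @` (cdom phi `&` B)).
Proof.
move=> aphi oB; rewrite chart_imgI // openE => y [iy By]; apply: filterI.
  exact: near_chart_img.
by apply: (cinv_continuous aphi iy); exact: open_nbhs_nbhs.
Qed.

Lemma smooth_transition (phi psi : chart R X n) : atlas phi -> atlas psi ->
  smooth_on [set y | chart_img phi y /\ cdom psi (cinv phi y)]
    (cmap psi \o cinv phi).
Proof.
by move=> aphi apsi; rewrite -chart_imgI //; have [_ _ _ _] := HX; exact.
Qed.

Lemma transition_differentiable (phi psi : chart R X n) y : atlas phi ->
  atlas psi -> chart_img phi y -> cdom psi (cinv phi y) ->
  differentiable (cmap psi \o cinv phi) y.
Proof.
by move=> aphi apsi iy dy; have [/(_ y) + _] := smooth_transition aphi apsi 1;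
  exact.
Qed.

Lemma is_diff_from_chart (phi : chart R X n) y : atlas phi -> chart_img phi y ->
  is_diff y (cmap (chart_at (cinv phi y)) \o cinv phi) (from_chart phi y).
Proof.
move=> aphi iy; apply: differentiableP; have [? ?] :=
  manifold_chart_atP (cinv phi y).
exact: transition_differentiable.
Qed.

Lemma is_diff_to_chart (phi : chart R X n) x : atlas phi -> cdom phi x ->
  is_diff (cmap (chart_at x) x) (cmap phi \o cinv (chart_at x)) (to_chart phi
    x).
Proof.
move=> aphi Dx; apply: differentiableP; have [a d] := manifold_chart_atP x.
by apply: transition_differentiable => //; [exists x|rewrite chart_cmapK].
Qed.

Lemma is_diff_chart_id (phi : chart R X n) y : atlas phi -> chart_img phi y ->
  is_diff y (cmap phi \o cinv phi) id.
Proof.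
move=> aphi iy; apply: is_diff_near_eq (is_diff_id y).
by apply: filterS (near_chart_img aphi iy) => z iz /=;
  have [_ ->] := chart_cinvP aphi iz.
Qed.

(** The composite of the two transition maps is the identity only near [y]; by locality its
    derivative is still the identity, and by the chain rule it is [dg \o df]. *)
Lemma is_diff_transition_inv (phi psi : chart R X n) y df dg : atlas phi ->
  atlas psi -> chart_img phi y -> cdom psi (cinv phi y) ->
  is_diff y (cmap psi \o cinv phi) df ->
  is_diff (cmap psi (cinv phi y)) (cmap phi \o cinv psi) dg ->
  forall u, dg (df u) = u.
Proof.
move=> aphi apsi iy dy dfP dgP u.
have H : is_diff y ((cmap phi \o cinv psi) \o (cmap psi \o cinv phi)) (dg \o
  df).
  exact: is_diff_comp.
have Hid : is_diff y ((cmap phi \o cinv psi) \o (cmap psi \o cinv phi)) id.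
  apply: is_diff_near_eq (is_diff_id y).
  have nd : \forall z \near y, cdom psi (cinv phi z).
    by apply: (cinv_continuous aphi iy); exact: near_cdom.
  apply: filterS (filterI (near_chart_img aphi iy) nd) => z [iz dz] /=.
  by rewrite chart_cmapK //; have [_ ->] := chart_cinvP aphi iz.
by case: H => _ E; case: Hid => _; rewrite E => /(congr1 (@^~ u)).
Qed.

(** The previous lemma is applied to the transition from [chart_at] to [phi]. This cancellation is
    what allows the coordinate form of an endomorphism to be fed to the coordinate form of a
    tensor. *)
Lemma to_chartK (phi : chart R X n) y u : atlas phi -> chart_img phi y ->
  from_chart phi y (to_chart phi (cinv phi y) u) = u.
Proof.
move=> aphi iy; have [a d] := manifold_chart_atP (cinv phi y).
have [Dy Ky] := chart_cinvP aphi iy.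
have F := is_diff_from_chart aphi iy.
have T := is_diff_to_chart aphi Dy.
have /= H := @is_diff_transition_inv _ phi _ (to_chart phi (cinv phi y))
  (from_chart phi y) a aphi (ex_intro2 _ _ _ d erefl).
rewrite (chart_cmapK a d) Ky in H; exact: (H Dy T F u).
Qed.

Lemma to_chart_at (x : X) u : to_chart (chart_at x) x u = u.
Proof.
have [a d] := manifold_chart_atP x.
have [|_ E] := @is_diff_chart_id (chart_at x) (cmap (chart_at x) x) a.
  by exists x.
by rewrite /to_chart E.
Qed.

Lemma from_chart_at (x : X) u : from_chart (chart_at x) (cmap (chart_at x) x) u
  = u.
Proof.
have [a d] := manifold_chart_atP x.
rewrite -[in LHS](to_chart_at x u) -[X in to_chart _ X](chart_cmapK a d).
by rewrite to_chartK //; exists x.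
Qed.

End Charts.

(** * Products and open subsets of the line *)

Lemma continuous_at_comp {S T U : topologicalType} (f : S -> T) (g : T -> U) s :
  {for s, continuous f} -> {for f s, continuous g} ->
  {for s, continuous (fun x => g (f x))}.
Proof. exact: continuous_comp. Qed.

Lemma continuous_at_pair {S T U : topologicalType} (f : S -> T) (g : S -> U) s :
  {for s, continuous f} -> {for s, continuous g} ->
  {for s, continuous (fun x => (f x, g x))}.
Proof. by move=> fC gC; exact: cvg_pair. Qed.

Section TopologyAux.
Context {S T : topologicalType}.

Lemma hausdorff_injective (f : S -> T) : continuous f -> injective f ->
  hausdorff_space T -> hausdorff_space S.
Proof.
move=> cf injf hT p q pq; apply/injf/hT => A B pA qB.
by have [x [Ax Bx]] := pq _ _ (cf p A pA) (cf q B qB); exists (f x).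
Qed.

Lemma hausdorff_prod : hausdorff_space S -> hausdorff_space T ->
  hausdorff_space (S * T)%type.
Proof.
move=> hS hT [p1 p2] [q1 q2] pq; congr pair.
  apply: hS => A B pA qB.
  have [|//|[x y] [/= [Ax _] [Bx _]]] := pq (A `*` setT) (B `*` setT).
  - by exists (A, setT) => //; split=> //; exact: filterT.
  - by exists (B, setT) => //; split=> //; exact: filterT.
  by exists x.
apply: hT => A B pA qB.
have [|//|[x y] [/= [_ Ay] [_ By]]] := pq (setT `*` A) (setT `*` B).
- by exists (setT, A) => //; split=> //; exact: filterT.
- by exists (setT, B) => //; split=> //; exact: filterT.
by exists y.
Qed.

Lemma open_setX (A : set S) (B : set T) : open A -> open B -> open (A `*` B).
Proof.
move=> oA oB; rewrite openE => -[x y] [/= Ax By]; exists (A, B) => //.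
by split; apply: open_nbhs_nbhs.
Qed.

Lemma second_countable_prod : @second_countable S -> @second_countable T ->
  @second_countable (S * T)%type.
Proof.
move=> [BS cS [oS bS]] [BT cT [oT bT]].
exists [set p.1 `*` p.2 | p in BS `*` BT].
  apply: (card_le_trans (card_image_le _ _)); exact: countableX.
split=> [_ [[A B] [/= /oS oA /oT oB] <-]|[x y] U [[A B] [/= xA yB] ABU]].
  exact: open_setX.
have [A' [BA' A'x] A'A] := bS x A xA; have [B' [BB' B'y] B'B] := bT y B yB.
exists (A' `*` B'); first by split=> //; exists (A', B').
by move=> [a b] [/= /A'A Aa /B'B Bb]; apply: ABU.
Qed.

End TopologyAux.

(** The traces on [A] of intervals with rational ends form the base. *)
Lemma second_countable_subset {R : realType} (A : set R) :
  @second_countable A.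
Proof.
pose B (pq : rat * rat) : set A := val @^-1` `]ratr pq.1, ratr pq.2[%classic.
exists (range B).
  by apply: (card_le_trans (card_image_le _ _)); exact: countableP.
split=> [_ [[p q] _ <-]|x U].
  by exists `]ratr p, ratr q[%classic => //; exact: itv_open.
case=> _ [[V oV <-] /= Vx VU].
have [e /= e0 eV] : nbhs_ball (val x) V by apply/nbhs_ballP/open_nbhs_nbhs.
have [p] : exists p : rat, ratr p \in `](val x - e), (val x)[.
  by apply: rat_in_itvoo; rewrite ltrBlDr ltrDl.
have [q] : exists q : rat, ratr q \in `](val x), (val x + e)[.
  by apply: rat_in_itvoo; rewrite ltrDl.
rewrite !in_itv /= => /andP[xq qe] /andP[ep px].
exists (B (p, q)); first by split; [exists (p, q)|rewrite /B /= in_itv /= px].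
move=> z; rewrite /B /= in_itv /= => /andP[pz zq]; apply: VU; apply: eV.
rewrite /ball /= ltr_distlC; apply/andP; split.
  exact: lt_trans pz.
exact: lt_trans qe.
Qed.

Section ProductManifold.
Context {R : realType} {m n : nat} (X : charted_space R m) (Y : charted_space R
  n).

Lemma linear_lsubmx : linear (@lsubmx R 1 m n).
Proof. by move=> a u v; apply/rowP => i; rewrite !mxE. Qed.

Lemma linear_rsubmx : linear (@rsubmx R 1 m n).
Proof. by move=> a u v; apply/rowP => i; rewrite !mxE. Qed.

Lemma prod_chart_img (phi : chart R X m) (psi : chart R Y n) :
  chart_img (prod_chart phi psi) =
  [set w | chart_img phi (lsubmx w) /\ chart_img psi (rsubmx w)].
Proof.
apply/seteqP; split=> [_ [[x y] [/= Dx Dy] <-]|w [/= [x Dx xE] [y Dy yE]]] /=.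
  by rewrite row_mxKl row_mxKr; split; [exists x|exists y].
by exists (x, y) => //=; rewrite xE yE hsubmxK.
Qed.

Hypothesis HX : is_manifold X.
Hypothesis HY : is_manifold Y.

Lemma row_mx_continuous_at (T : topologicalType) (f : T -> 'rV[R]_m)
  (g : T -> 'rV[R]_n) t : {for t, continuous f} -> {for t, continuous g} ->
  {for t, continuous (fun s => row_mx (f s) (g s))}.
Proof.
move=> fC gC.
have -> : (fun s => row_mx (f s) (g s)) =
    (fun s => row_mx (f s) 0 + row_mx 0 (g s)) :> (T -> 'rV[R]_(m + n)).
  by apply/funext => s; rewrite row_mxDlr.
apply: continuousD.
  apply: (continuous_at_comp (g :=
    fun v : 'rV[R]_m => row_mx v (0 : 'rV[R]_n)) fC).
  exact: (rV_linear_continuous (@linear_row_mxl _ _ _)).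
apply: (continuous_at_comp (g :=
  fun v : 'rV[R]_n => row_mx (0 : 'rV[R]_m) v) gC).
exact: (rV_linear_continuous (@linear_row_mxr _ _ _)).
Qed.

Lemma prod_manifold : is_manifold (prod_space X Y).
Proof.
have [hX sX cX aX tX] := HX; have [hY sY cY aY tY] := HY; split.
- exact: hausdorff_prod.
- exact: second_countable_prod.
- move=> [x y]; have [ax dx] := cX x; have [ay dy] := cY y.
  by split=> //; exists (chart_at x), (chart_at y).
- move=> _ [phi [psi [aphi apsi ->]]].
  have [oD1 oI1 K1 cm1 ci1] := aX _ aphi.
  have [oD2 oI2 K2 cm2 ci2] := aY _ apsi; split.
  + exact: (open_setX oD1 oD2).
  + rewrite prod_chart_img openE => w [i1 i2]; apply: filterI.
      apply: (@continuous_lsubmx _ _ _ _ w); exact: near_chart_img.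
    apply: (@continuous_rsubmx _ _ _ _ w); exact: near_chart_img.
  + by move=> [x y] /= [dx dy]; rewrite row_mxKl row_mxKr K1 // K2.
  + move=> [x y] /= [dx dy]; apply: row_mx_continuous_at.
      by apply: continuous_comp; [exact: cvg_fst|exact: cm1].
    by apply: continuous_comp; [exact: cvg_snd|exact: cm2].
  + rewrite prod_chart_img => w [i1 i2]; apply: continuous_at_pair.
      exact: (continuous_at_comp (@continuous_lsubmx _ _ _ _ w) (ci1 _ i1)).
    exact: (continuous_at_comp (@continuous_rsubmx _ _ _ _ w) (ci2 _ i2)).
- move=> _ _ [phi [psi [aphi apsi ->]]] [phi' [psi' [aphi' apsi' ->]]] k.
  set U := (U in Ck k U _).
  (* The transition domain is a product of transition domains: it is open, and each block of the
     transition map is that of one factor after a linear projection. *)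
  have UE : U = [set w | (cmap phi @` (cdom phi `&` cdom phi')) (lsubmx w)] `&`
                [set w | (cmap psi @` (cdom psi `&` cdom psi')) (rsubmx w)].
    apply/seteqP; split=> [_ [[x y] [/= [D1 D2] [D1' D2']] <-]|].
      by rewrite /= row_mxKl row_mxKr; split; [exists x|exists y].
    move=> w [[x [D1 D1'] xE] [y [D2 D2'] yE]]; exists (x, y) => //=.
    by rewrite xE yE hsubmxK.
  have o1 := open_chart_imgI HX aphi (open_cdom HX aphi').
  have o2 := open_chart_imgI HY apsi (open_cdom HY apsi').
  have oU : open U.
    rewrite UE; apply: openI.
      by apply: open_comp o1 => w _; exact: continuous_lsubmx.
    by apply: open_comp o2 => w _; exact: continuous_rsubmx.
  apply: (Ck_row_mx (f := fun w => cmap phi' (cinv phi (lsubmx w)))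
    (g := fun w => cmap psi' (cinv psi (rsubmx w)))) => //.
    apply: (Ck_sub _ (Ck_comp_rV_linear linear_lsubmx (tX _ _ aphi aphi' k))).
    by rewrite UE => w [].
  apply: (Ck_sub _ (Ck_comp_rV_linear linear_rsubmx (tY _ _ apsi apsi' k))).
  by rewrite UE => w [].
Qed.

(** By conversion, the change of coordinates of a product chart is the row of those of the factors,
    each precomposed with a block projection, so its derivative splits. *)
Lemma from_prod_chart (phi : chart R X m) (psi : chart R Y n) w u :
  atlas phi -> atlas psi -> chart_img phi (lsubmx w) ->
    chart_img psi (rsubmx w) ->
  @from_chart _ _ (prod_space X Y) (prod_chart phi psi) w u =
  row_mx (from_chart phi (lsubmx w) (lsubmx u)) (from_chart psi (rsubmx w)
    (rsubmx u)).
Proof.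
move=> aphi apsi i1 i2.
have := is_diff_row_mx
  (is_diff_comp_linear linear_lsubmx (is_diff_from_chart HX aphi i1))
  (is_diff_comp_linear linear_rsubmx (is_diff_from_chart HY apsi i2)).
by case=> _ /(congr1 (@^~ u)).
Qed.

Lemma to_prod_chart (phi : chart R X m) (psi : chart R Y n) (p : prod_space X
  Y) u :
  atlas phi -> atlas psi -> cdom phi p.1 -> cdom psi p.2 ->
  @to_chart _ _ (prod_space X Y) (prod_chart phi psi) p u =
  row_mx (to_chart phi p.1 (lsubmx u)) (to_chart psi p.2 (rsubmx u)).
Proof.
case: p => x y aphi apsi /= i1 i2.
set w := cmap (chart_at ((x, y) : prod_space X Y)) (x, y).
have wl : lsubmx w = cmap (chart_at x) x by rewrite row_mxKl.
have wr : rsubmx w = cmap (chart_at y) y by rewrite row_mxKr.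
have d1 := is_diff_to_chart HX aphi i1; rewrite -wl in d1.
have d2 := is_diff_to_chart HY apsi i2; rewrite -wr in d2.
have := is_diff_row_mx
  (is_diff_comp_linear linear_lsubmx d1) (is_diff_comp_linear linear_rsubmx d2).
by case=> _ /(congr1 (@^~ u)).
Qed.

End ProductManifold.

Section LineManifold.
Context {R : realType} (A : set R).
Implicit Types (a b : A) (w : 'rV[R]_1).

Lemma line_chart_img a : chart_img (line_chart a) = [set w | A (w 0 0)].
Proof.
apply/seteqP; split=> [_ [t _ <-]|w Aw] /=; first by rewrite mxE eqxx;
  exact: set_valP.
by exists (exist _ (w 0 0) (mem_set Aw)) => //=; apply/rowP => i;
  rewrite !ord1 mxE eqxx.
Qed.

Lemma val_line_cinv a w : A (w 0 0) -> val (cinv (line_chart a) w) = w 0 0.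
Proof. by move=> Aw; rewrite /= val_insubd mem_set. Qed.

Lemma line_cmap_cinv a b w : A (w 0 0) ->
  cmap (line_chart b) (cinv (line_chart a) w) = w.
Proof.
by move=> Aw; apply/rowP => i; rewrite !ord1 /= val_insubd mem_set // mxE eqxx.
Qed.

Hypothesis oA : open A.

Lemma open_line_chart_img : open [set w : 'rV[R]_1 | A (w 0 0)].
Proof. by apply: open_comp oA => w _; exact: coord_continuous. Qed.

Lemma near_line_chart_img (w : 'rV[R]_1) : A (w 0 0) ->
  \forall w' \near w, A ((w' : 'rV[R]_1) 0 0).
Proof. by move=> Aw; apply: (open_nbhs_nbhs (conj open_line_chart_img Aw)). Qed.

Lemma continuous_into_subset {T : topologicalType} (f : T -> A) t :
  {for t, continuous (fun x => val (f x))} -> {for t, continuous f}.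
Proof.
move=> fC B [_ [[V oV <-] /= Vft VB]].
have : nbhs t ((fun x => val (f x)) @^-1` V) by apply: fC;
  exact: open_nbhs_nbhs.
by apply: filterS => x; exact: VB.
Qed.

Lemma continuous_subset_val : continuous (fun t : A => val t).
Proof. exact: initial_continuous. Qed.

(** All charts share one coordinate map and their inverses agree over [A], so every transition map
    is the identity on the open chart image. *)
Lemma line_manifold : is_manifold (line_space A).
Proof.
split.
- apply: (hausdorff_injective continuous_subset_val) => [s t /val_inj //|].
  exact: Rhausdorff.
- exact: second_countable_subset.
- by move=> a; split=> //; exists a.
- move=> _ [a _ <-]; rewrite line_chart_img; split.
  + exact: openT.
  + exact: open_line_chart_img.
  + by move=> t _; apply: val_inj; rewrite val_line_cinv mxE eqxx //;
    exact: set_valP.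
  + move=> t _; apply: (@continuous_at_comp _ _ _ (fun t : A => val t) (fun x :
    R => x%:M : 'rV[R]_1)).
      exact: continuous_subset_val.
    apply: (@Ck_scalar_mx _ _ 0 setT id openT _ _ I) => x _; exact: cvg_id.
  + move=> w Aw; apply: continuous_into_subset.
    rewrite /prop_for /continuous_at val_line_cinv //.
    apply: cvg_trans (@coord_continuous _ _ _ 0 0 w).
    have E : \forall w' \near w, (w' : 'rV[R]_1) 0 0 =
      val (cinv (line_chart a) w').
      by apply: filterS (near_line_chart_img Aw) => w' Aw';
        rewrite val_line_cinv.
    exact: near_eq_cvg E.
- move=> _ _ [a _ <-] [b _ <-] k.
  rewrite setTI; apply: (Ck_ext (f := id)).
  + by rewrite -[X in open X]/(chart_img (line_chart a)) line_chart_img;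
    exact: open_line_chart_img.
  + by rewrite -[X in forall x, X x ->
    _]/(chart_img (line_chart a)) line_chart_img => w Aw;
      rewrite [RHS]line_cmap_cinv.
  + exact: Ck_rV_linear.
Qed.

Lemma is_diff_line a b w : A (w 0 0) ->
  is_diff w (cmap (line_chart b) \o cinv (line_chart a)) id.
Proof.
move=> Aw; apply: is_diff_near_eq (is_diff_id w).
by apply: filterS (near_line_chart_img Aw) => w' Aw';
  rewrite /comp line_cmap_cinv.
Qed.

Lemma from_line_chart a w u : A (w 0 0) ->
  @from_chart _ _ (line_space A) (line_chart a) w u = u.
Proof. by move=> Aw; have [_ /(congr1 (@^~ u))] :=
  is_diff_line a (cinv (line_chart a) w) Aw. Qed.

Lemma to_line_chart a (t : line_space A) u :
  @to_chart _ _ (line_space A) (line_chart a) t u = u.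
Proof.
have At : A ((cmap (line_chart t) t) 0 0) by rewrite mxE eqxx; exact: set_valP.
by have [_ /(congr1 (@^~ u))] := is_diff_line t a At.
Qed.

End LineManifold.

(** * Positive definite and Lorentzian forms *)

Section PositiveDefinite.
Context {R : realType}.

Definition mxform n (G : 'M[R]_n) (u v : 'rV[R]_n) : R := (u *m G *m v^T) 0 0.

Lemma mxformDl n (G : 'M[R]_n) u1 u2 v :
  mxform G (u1 + u2) v = mxform G u1 v + mxform G u2 v.
Proof. by rewrite /mxform !mulmxDl mxE. Qed.

Lemma mxformZl n (G : 'M[R]_n) a u v : mxform G (a *: u) v = a * mxform G u v.
Proof. by rewrite /mxform -!scalemxAl mxE. Qed.

Lemma mxformC n (G : 'M[R]_n) u v : G^T = G -> mxform G u v = mxform G v u.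
Proof.
move=> Gsym; rewrite /mxform -[LHS]trace_mx11 -mxtrace_tr trace_mx11.
by rewrite !trmx_mul trmxK Gsym mulmxA.
Qed.

Definition posdef n (G : 'M[R]_n) : Prop :=
  G^T = G /\ forall v : 'rV[R]_n, v != 0 -> 0 < mxform G v v.

(** Symmetric Gaussian elimination by induction on the size: split off the first basis vector, and
    treat its orthogonal complement through the Schur complement. *)
Lemma posdef_congruent1 n (G : 'M[R]_n) : posdef G ->
  exists2 C : 'M[R]_n, C \in unitmx & C *m G *m C^T = 1%:M.
Proof.
elim: n G => [|n IH] G.
  by move=> _; exists 1%:M; [exact: unitmx1|apply/matrixP => -[]].
change (posdef (G : 'M[R]_(1 + n)) -> exists2 C : 'M[R]_(1 + n),
  C \in unitmx & C *m G *m C^T = 1%:M).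
move=> [Gsym Gpos].
set a := G 0 0; pose b : 'rV[R]_n := ursubmx (G : 'M[R]_(1 + n)).
pose D := drsubmx (G : 'M[R]_(1 + n)).
have GE : (G : 'M[R]_(1 + n)) = block_mx a%:M b b^T D.
  rewrite -[LHS](@submxK _ 1 n 1 n) -/b -/D; congr block_mx.
    by apply/matrixP => i j; rewrite !ord1 !mxE eqxx; congr (G _ _);
      exact/val_inj.
  by rewrite /b -[X in dlsubmx X]Gsym trmx_ursub.
have a0 : 0 < a.
  have /Gpos : row_mx 1%:M 0 != 0 :> 'rV[R]_(1 + n).
    apply/eqP => /(congr1 lsubmx); rewrite row_mxKl raddf0 => /matrixP/(_ 0 0).
    by rewrite !mxE eqxx => /eqP; rewrite oner_eq0.
  rewrite /mxform GE mul_row_block tr_row_mx mul_row_col !mul1mx !mul0mx !addr0.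
  by rewrite trmx0 mulmx0 addr0 trmx1 mulmx1 mxE eqxx.
(* Schur complement of the first diagonal entry *)
pose S := D - a^-1 *: (b^T *m b).
have [|C uC CE] := IH S.
  split.
    rewrite /S raddfB /= linearZ /= trmx_mul trmxK; congr (_ - _).
    by rewrite /D trmx_drsub Gsym.
  (* The first entry makes the first block of the product with [G] vanish and leaves [u *m S] as the
     second, so the form of [G] at this vector is that of [S] at [u]. *)
  move=> u u0; have /Gpos : row_mx (- (a^-1 *: (u *m b^T))) u != 0.
    by apply: contra u0 => /eqP/(congr1 rsubmx); rewrite row_mxKr raddf0 => ->.
  rewrite /mxform GE mul_row_block mul_mx_scalar scalerN scalerA mulfV ?gt_eqF
    //.
  rewrite scale1r addNr tr_row_mx mul_row_col mul0mx add0r.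
  rewrite /S mulmxBr -scalemxAr mulmxA.
  by rewrite mulNmx -scalemxAl addrC.
pose s := Num.sqrt a.
have s0 : 0 < s by rewrite sqrtr_gt0.
have ss : s * s = a by rewrite -expr2 sqr_sqrtr // ltW.
(* The first row is the first basis vector divided by its length [s]; the others lift the rows of
   [C] to vectors orthogonal to it for [G]. *)
pose C' : 'M[R]_(1 + n) := block_mx (s^-1)%:M 0 (- (a^-1 *: (C *m b^T))) C.
have E : C' *m (G : 'M[R]_(1 + n)) = block_mx s%:M (s^-1 *: b) 0 (C *m S).
  rewrite GE /C' mulmx_block !mul0mx !addr0 -scalar_mxM mul_scalar_mx
    mul_mx_scalar.
  rewrite -ss mulrA mulVf ?gt_eqF // mul1r ss scalerN scalerA mulfV ?gt_eqF //.
  rewrite scale1r addNr; congr block_mx.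
  by rewrite /S mulmxBr -scalemxAr mulmxA mulNmx -scalemxAl addrC.
have E1 : C' *m (G : 'M[R]_(1 + n)) *m C'^T = 1%:M.
  rewrite E /C' tr_block_mx mulmx_block trmx0 tr_scalar_mx !mul0mx !mulmx0 CE.
  rewrite addr0 !add0r -scalar_mxM mulfV ?gt_eqF // mul_scalar_mx.
  rewrite scalar_mx_block; congr block_mx.
  rewrite raddfN /= linearZ /= trmx_mul trmxK scalerN scalerA -scalemxAl.
  by rewrite -ss invfM mulrA mulfV ?gt_eqF // mul1r addNr.
exists C' => //.
by have [] := mulmx1_unit E1; rewrite unitmx_tr.
Qed.

(** The Cauchy-Schwarz argument: if [v] paired nontrivially with some [u], moving from [v] a little
    along [u] would make the form negative. *)
Lemma psd_kernel n (G : 'M[R]_n) (v : 'rV[R]_n) : G^T = G ->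
  (forall u : 'rV[R]_n, 0 <= mxform G u u) -> mxform G v v = 0 -> v *m G = 0.
Proof.
move=> Gsym Gpos qv.
have vG u : mxform G v u = 0.
  set b := mxform G v u; set q := mxform G u u.
  have q0 : 0 <= q by exact: Gpos.
  have q1 : 0 < q + 1 by rewrite ltr_wpDl.
  (* The denominator [q + 1] instead of [q] is positive even where the form vanishes at [u]; the
     value obtained is still a negative multiple of [b ^+ 2]. *)
  have := Gpos (v + (- (b / (q + 1))) *: u).
  rewrite mxformDl mxformZl ![mxform G _ (_ + _)]mxformC // !mxformDl !mxformZl.
  rewrite qv (mxformC u v Gsym) -/b -/q.
  have -> : 0 + - (b / (q + 1)) * b + - (b / (q + 1)) * (b + - (b / (q + 1)) *
    q) =
    - ((b / (q + 1)) ^+ 2 * (q + 2)) by field; rewrite gt_eqF.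
  rewrite oppr_ge0 pmulr_lle0; last by rewrite ltr_wpDl.
  move=> bq.
  have /eqP : (b / (q + 1)) ^+ 2 = 0 by apply/eqP; rewrite eq_le sqr_ge0 bq.
  by rewrite sqrf_eq0 mulf_eq0 invr_eq0 (gt_eqF q1) orbF => /eqP.
apply/rowP => i; have := vG (delta_mx 0 i).
by rewrite /mxform trmx_delta -colE !mxE.
Qed.

Lemma mxformE n (G : 'M[R]_n) u v :
  mxform G u v = \sum_i \sum_j u 0 j * G j i * v 0 i.
Proof.
by rewrite /mxform mxE; apply: eq_bigr => i _; rewrite !mxE mulr_suml.
Qed.

(* On [0, 1] times the unit sphere, take a point with the least time at which
   the form is nonpositive; there the form is semidefinite and degenerate. *)
Lemma posdef_path n (G : R -> 'M[R]_n) (r : R) :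
  (forall rho, (G rho)^T = G rho) ->
  (forall i j, continuous (fun rho => G rho i j)) ->
  posdef (G 0) -> (forall s, 0 <= s <= 1 -> G (s * r) \in unitmx) ->
  posdef (G r).
Proof.
move=> Gsym Gcont G0 Gunit; split=> // v1 v10; rewrite ltNge; apply/negP => v1r.
pose tm (w : 'rV[R]_(1 + n)) : R := lsubmx w 0 0.
pose F (w : 'rV[R]_(1 + n)) := mxform (G (tm w * r)) (rsubmx w) (rsubmx w).
have tmC : continuous tm.
  by apply: rV_linear_continuous => a u v; rewrite /tm !mxE.
have vC i : continuous (fun w : 'rV[R]_(1 + n) => rsubmx w 0 i).
  by apply: rV_linear_continuous => a u v; rewrite !mxE.
have FC : continuous F.
  (* [Ck 0] is continuity, and its closure under sums and products applies to the expanded form. *)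
  suff : Ck 0 setT F by move=> FC w; exact: FC.
  have -> : F = fun w => \sum_i \sum_j rsubmx w 0 j * G (tm w * r) j i * rsubmx
    w 0 i.
    by apply/funext => w; rewrite /F mxformE.
  apply: Ck_sum => [|i]; first exact: openT.
  apply: Ck_sum => [|j]; first exact: openT.
  apply: Ck_mul; [exact: openT| |by move=> w _; exact: vC].
  apply: Ck_mul; [exact: openT|by move=> w _; exact: vC|] => w _.
  apply: (continuous_at_comp (f := fun w => tm w * r) (g := fun s => G s j i)).
    apply: (@continuousM _ _ tm (cst r)); [exact: tmC|exact: cst_continuous].
  exact: Gcont.
pose K := [set w | 0 <= tm w] `&` [set w | tm w <= 1] `&`
  [set w : 'rV[R]_(1 + n) | `|rsubmx w| = 1] `&` [set w | F w <= 0].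
have nC : continuous (fun w : 'rV[R]_(1 + n) => `|rsubmx w|).
  move=> w; apply: (continuous_at_comp (g := fun v : 'rV[R]_n => `|v|)).
    exact: continuous_rsubmx.
  exact: norm_continuous.
have Kclosed : closed K.
  apply: closedI; [apply: closedI; [apply: closedI|]|].
  - by apply: (@closed_comp _ _ tm [set x | 0 <= x]) => [w _|];
    [exact: tmC|exact: closed_ge].
  - by apply: (@closed_comp _ _ tm [set x | x <= 1]) => [w _|];
    [exact: tmC|exact: closed_le].
  - by apply: (@closed_comp _ _ (fun w : 'rV[R]_(1 + n) => `|rsubmx w|) [set x
    | x = 1]) => [w _|]; [exact: nC|exact: closed_eq].
  - by apply: (@closed_comp _ _ F [set x | x <= 0]) => [w _|];
    [exact: FC|exact: closed_le].
have Kbounded : bounded_set K.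
  exists 1; split; first exact: num_real.
  move=> M M1 w [[[t0 t1] v1n] _] /=; apply: le_trans (ltW M1).
  rewrite [leLHS]/Num.Def.normr /= mx_normrE; apply/bigmax_leP;
    split=> // -[i j] _ /=.
  rewrite -(hsubmxK w) mxE; case: splitP => k _.
    have -> : lsubmx w i k = tm w by rewrite /tm !ord1.
    by rewrite ger0_norm.
  rewrite -v1n [leRHS]/Num.Def.normr /= mx_normrE.
  exact: (le_bigmax _ (fun ij => `|rsubmx w ij.1 ij.2|) (i, k)).
have Kcompact := bounded_closed_compact Kbounded Kclosed.
have norm_scale (v : 'rV[R]_n) : v != 0 -> `| `|v|^-1 *: v| = 1.
  by move=> v0; rewrite normrZ ger0_norm ?invr_ge0 ?normr_ge0 // mulVf //
    normr_eq0.
have K0 : K !=set0.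
  exists (row_mx 1%:M (`|v1|^-1 *: v1)); split; [split; [split|]|] => /=;
    rewrite /F /tm ?row_mxKl ?row_mxKr ?mxE ?eqxx //= ?ler01 //.
    exact: norm_scale.
  rewrite mul1r mxformZl mxformC // mxformZl mulr_ge0_le0 ?invr_ge0 ?normr_ge0
    //.
  by rewrite mulr_ge0_le0 ?invr_ge0 ?normr_ge0.
have [w wK wmin] := EVT_min_rV K0 Kcompact (continuous_subspaceT tmC).
move: (wK); rewrite inE => -[[[/= t0 t1] wn] wF].
set v := rsubmx w in wn; set Gs := G (tm w * r).
have v0 : v != 0 by rewrite -normr_eq0 wn oner_eq0.
have tpos : 0 < tm w.
  rewrite lt_neqAle t0 andbT; apply/eqP => tw0.
  have [_ /(_ v v0)] := G0.
  by rewrite ltNge => /negP; apply; move: wF; rewrite /F -tw0 mul0r.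
(* A unit vector with a negative value at the least time would, by continuity, have one slightly
   earlier too, giving a point of [K] with smaller time. Positivity of [tm w] leaves room to its
   left inside the interval. *)
have sph u : `|u| = 1 -> 0 <= mxform Gs u u.
  move=> u1; rewrite leNgt; apply/negP => uneg.
  pose f (s : R) := mxform (G (s * r)) u u.
  have fC : continuous f.
    suff : Ck 0 setT f by move=> H s; exact: H.
    have -> : f = fun s => \sum_i \sum_j u 0 j * G (s * r) j i * u 0 i.
      by apply/funext => s; rewrite /f mxformE.
    apply: Ck_sum => [|i]; first exact: openT.
    apply: Ck_sum => [|j]; first exact: openT.
    apply: Ck_mul; [exact: openT| |exact: Ck_cst].
    apply: Ck_mul; [exact: openT|exact: Ck_cst|] => s _.
    apply: (continuous_at_comp (f := fun s : R => s * r : R)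
      (g := fun s : R => G s j i : R)).
      apply: (@continuousM _ _ id (cst r));
        [exact: cvg_id|exact: cst_continuous].
    exact: Gcont.
  have near_neg : \forall s \near tm w, f s < 0.
    exact: (fC (tm w) [set x | x < 0] (lt_nbhsl uneg)).
  have [s [s0 st fs]] : exists s, [/\ 0 < s, s < tm w & f s < 0].
    have : \forall s \near (tm w)^'-, [/\ 0 < s, s < tm w & f s < 0].
      near=> s; split.
      - by near: s; exact: nbhs_left_gt.
      - by near: s; exact: nbhs_left_lt.
      - by near: s; apply: cvg_within; exact: near_neg.
    by move=> /filter_ex.
  have : row_mx s%:M u \in K.
    rewrite inE; split; [split; [split|]|] => /=;
      rewrite /F /tm ?row_mxKl ?row_mxKr ?mxE ?eqxx //=.
    - exact: ltW.
    - exact: (ltW (lt_le_trans st t1)).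
    - exact: ltW.
  move/wmin; have -> : tm (row_mx s%:M u) = s by rewrite /tm row_mxKl mxE eqxx.
  by rewrite leNgt st.
have psd u : 0 <= mxform Gs u u.
  have [->|u0] := eqVneq u 0; first by rewrite /mxform !mul0mx mxE.
  have := sph _ (norm_scale _ u0);
    rewrite mxformZl (mxformC _ _ (Gsym _)) mxformZl.
  by rewrite mulrA pmulr_rge0 // mulr_gt0 // invr_gt0 normr_gt0.
have vG : v *m Gs = 0.
  apply: (psd_kernel (Gsym _) psd); apply/eqP; rewrite eq_le psd andbT;
    exact: wF.
have uGs : Gs \in unitmx by apply: Gunit; rewrite t0.
by case/eqP: v0; rewrite -[v](mulmxK uGs) vG mul0mx.
Unshelve. all: by end_near. Qed.

Lemma posdef_orthonormal_basis n (G : 'M[R]_n) : posdef G ->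
  exists2 C : 'M[R]_n, C \in unitmx &
    forall i j, mxform G (row i C) (row j C) = (i == j)%:R.
Proof.
move=> /posdef_congruent1[C uC CE]; exists C => // i j.
move/matrixP/(_ i j): CE; rewrite [in X in _ = X -> _]mxE => <-.
rewrite /mxform -row_mul !mxE; apply: eq_bigr => k _.
by rewrite !mxE.
Qed.

(** These three projections serve both for points of a chart, as (t, rho, x), and for tangent
    vectors, as (dt, drho, dx). *)
Definition tcoord n (w : 'rV[R]_(1 + (1 + n))) : R := lsubmx w 0 0.
Definition rcoord n (w : 'rV[R]_(1 + (1 + n))) : R := lsubmx (rsubmx w) 0 0.
Definition xcoord n (w : 'rV[R]_(1 + (1 + n))) : 'rV[R]_n := rsubmx (rsubmx w).

Lemma linear_tcoord n : linear (@tcoord n).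
Proof. by move=> a u v; rewrite /tcoord !mxE. Qed.

Lemma linear_rcoord n : linear (@rcoord n).
Proof. by move=> a u v; rewrite /rcoord !mxE. Qed.

Lemma linear_xcoord n : linear (@xcoord n).
Proof. by move=> a u v; apply/rowP => i; rewrite /xcoord !mxE. Qed.

Lemma tcoord_row n p q (x : 'rV[R]_n) : tcoord (row_mx p%:M (row_mx q%:M x)) =
  p.
Proof. by rewrite /tcoord row_mxKl mxE eqxx. Qed.

Lemma rcoord_row n p q (x : 'rV[R]_n) : rcoord (row_mx p%:M (row_mx q%:M x)) =
  q.
Proof. by rewrite /rcoord row_mxKr row_mxKl mxE eqxx. Qed.

Lemma xcoord_row n p q (x : 'rV[R]_n) : xcoord (row_mx p%:M (row_mx q%:M x)) =
  x.
Proof. by rewrite /xcoord !row_mxKr. Qed.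

(* The coefficients are grouped as in d(rho t) (x) dt + dt (x) d(rho t). *)
Definition lorentz_form n (t rho : R) (G : 'rV[R]_n -> 'rV[R]_n -> R)
    (u v : 'rV[R]_(1 + (1 + n))) : R :=
  (rho * tcoord u + t * rcoord u) * tcoord v
  + tcoord u * (rho * tcoord v + t * rcoord v)
  + t ^+ 2 * G (xcoord u) (xcoord v).

Lemma lorentz_form_signature n (t rho : R) (G : 'M[R]_n) : 0 < t -> posdef G ->
  @has_signature R 1 n.+1 (lorentz_form t rho (mxform G)).
Proof.
move=> t0 Gpos; have tn0 : t != 0 by rewrite gt_eqF.
have [C uC CE] := posdef_orthonormal_basis Gpos.
(* The vectors (1, b e, 0), e = -1, 1, are orthogonal and have square e. *)
pose b (e : R) := (e - 2 * rho) / (2 * t).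
pose r (e : R) : 'rV[R]_(1 + (1 + n)) := row_mx 1%:M (row_mx (b e)%:M 0).
(* Dividing a [G]-orthonormal basis by [t] absorbs the factor [t ^+ 2] of the form. *)
pose E : 'M[R]_(n, 1 + (1 + n)) := row_mx 0 (row_mx 0 (t^-1 *: C)).
pose B : 'M[R]_(1 + (1 + n)) := col_mx (r (-1)) (col_mx (r 1) E).
have formE (p q p' q' : R) (x y : 'rV[R]_n) :
    lorentz_form t rho (mxform G) (row_mx p%:M (row_mx q%:M x)) (row_mx p'%:M
      (row_mx q'%:M y))
    = (rho * p + t * q) * p' + p * (rho * p' + t * q') + t ^+ 2 * mxform G x y.
  by rewrite /lorentz_form !tcoord_row !rcoord_row !xcoord_row.
have form0l x : mxform G 0 x = 0 by rewrite /mxform !mul0mx mxE.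
have form0r x : mxform G x 0 = 0 by rewrite /mxform trmx0 !mulmx0 mxE.
have rowE k : row k E = row_mx 0%:M (row_mx 0%:M (t^-1 *: row k C)).
  by rewrite /E !row_row_mx !row0 linearZ /= !raddf0.
have Gsym := Gpos.1.
exists B.
  (* Independence of the rows: the block of the two plane vectors has determinant [b 1 - b (-1)],
     which is [t^-1], and [C] is invertible. *)
  suff H (v0 v1 : 'rV[R]_1) (vx : 'rV[R]_n) : row_mx v0 (row_mx v1 vx) *m B =
    0 ->
      row_mx v0 (row_mx v1 vx) = 0.
    rewrite -row_free_unit; apply/inj_row_free => v.
    have := H (lsubmx (v : 'rV[R]_(1 + (1 + n))))
      (lsubmx (rsubmx (v : 'rV[R]_(1 + (1 + n)))))
      (rsubmx (rsubmx (v : 'rV[R]_(1 + (1 + n))))).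
    by rewrite !hsubmxK.
  rewrite /B !mul_row_col.
  rewrite /r /E !mul_mx_row !mulmx0 !add_row_mx !addr0 !add0r.
  move=> /eqP; rewrite row_mx_eq0 => /andP[/eqP e1]; rewrite row_mx_eq0.
  move=> /andP[/eqP e2 /eqP e3].
  rewrite !mulmx1 in e1; rewrite !mul_mx_scalar in e2.
  have v01 : v0 = - v1 by apply/eqP; rewrite -addr_eq0 e1.
  have v10 : v1 = 0.
    move: e2; rewrite v01 scalerN -scaleNr -scalerDl => /eqP.
    rewrite scaler_eq0 => /orP[/eqP be|/eqP //].
    have : t^-1 = 0 by rewrite -be /b; field.
    by move/eqP; rewrite invr_eq0 (negbTE tn0).
  have vx0 : vx = 0.
    move: e3; rewrite -scalemxAr => /eqP;
      rewrite scaler_eq0 invr_eq0 (negbTE tn0) /=.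
    by move=> /eqP vC; rewrite -[vx](mulmxK uC) vC mul0mx.
  by rewrite v01 v10 vx0 oppr0 !row_mx0.
move=> i j.
have rB0 (k : 'I_1) : row (lshift (1 + n) k) B =
  r (-1) by rewrite /B rowKu row_id.
have rB1 (k : 'I_1) : row (rshift 1 (lshift n k)) B =
  r 1 by rewrite /B rowKd rowKu row_id.
have rBx (k : 'I_n) : row (rshift 1 (rshift 1 k)) B =
    row_mx 0%:M (row_mx 0%:M (t^-1 *: row k C)) by rewrite /B !rowKd rowE.
have bE e : rho + t * b e = e / 2 by rewrite /b; field.
have CEk k l : mxform G (t^-1 *: row k C) (t^-1 *: row l C) =
  t^-2 * (k == l)%:R.
  rewrite mxformZl (mxformC _ _ Gsym) mxformZl (mxformC _ _ Gsym) CE mulrA.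
  by rewrite -invfM -expr2.
(* Nine pairs of blocks. By [bE], plane vectors with parameters e and e' pair to (e + e') / 2, hence
   to -1, 0 or 1; mixed pairs with [E] vanish. *)
case: (@split_ordP 1 (1 + n) i) => [i'|i1] ->;
  [|case: (@split_ordP 1 n i1) => i' ->];
 (case: (@split_ordP 1 (1 + n) j) => [j'|j1] ->;
   [|case: (@split_ordP 1 n j1) => j' ->]);
 rewrite ?rB0 ?rB1 ?rBx formE ?(eq_lshift, eq_rshift, eq_lrshift, eq_rlshift,
   ord1, eqxx).
all: rewrite ?mulr1 ?mulr0 ?addr0 ?add0r ?form0l ?form0r ?mulr0 ?mul1r ?mul0r
  ?addr0 ?bE.
all: rewrite ?CEk; try by field.
by rewrite (@eq_rshift 1 n i' j') add0r mulrA mulfV ?expf_neq0 // mul1r;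
  case: eqP.
Qed.

End PositiveDefinite.

(** * Metrics and the ambient manifold *)

Section Bilinear.
Context {R : realType} {n : nat} (h : 'rV[R]_n -> 'rV[R]_n -> R).
Hypothesis hbil : bilinear_for *%R *%R h.

Lemma bilinDl u1 u2 v : h (u1 + u2) v = h u1 v + h u2 v.
Proof. by have : h (1 *: u1 + u2) v = 1 * h u1 v + h u2 v := hbil.1 v 1 u1 u2;
  rewrite scale1r mul1r. Qed.

Lemma bilin0l v : h 0 v = 0.
Proof. by have := bilinDl 0 0 v; rewrite addr0 -[LHS]addr0 => /addrI. Qed.

Lemma bilinZl a u v : h (a *: u) v = a * h u v.
Proof. by have : h (a *: u + 0) v = a * h u v + h 0 v := hbil.1 v a u 0;
   rewrite addr0 bilin0l addr0. Qed.

Lemma bilinDr u v1 v2 : h u (v1 + v2) = h u v1 + h u v2.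
Proof. by have : h u (1 *: v1 + v2) = 1 * h u v1 + h u v2 := hbil.2 u 1 v1 v2;
  rewrite scale1r mul1r. Qed.

Lemma bilin0r u : h u 0 = 0.
Proof. by have := bilinDr u 0 0; rewrite addr0 -[LHS]addr0 => /addrI. Qed.

Lemma bilinZr a u v : h u (a *: v) = a * h u v.
Proof. by have : h u (a *: v + 0) = a * h u v + h u 0 := hbil.2 u a v 0;
   rewrite addr0 bilin0r addr0. Qed.

Lemma bilin_suml u v : h u v = \sum_i u 0 i * h (delta_mx 0 i) v.
Proof.
rewrite [in LHS](row_sum_delta u) (big_morph (h^~ v) (id1 := 0) (op1 := +%R)).
- by apply: eq_bigr => i _; rewrite bilinZl.
- by move=> u1 u2; rewrite bilinDl.
- exact: bilin0l.
Qed.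

Lemma bilin_sumr u v : h u v = \sum_i v 0 i * h u (delta_mx 0 i).
Proof.
rewrite [in LHS](row_sum_delta v) (big_morph (h u) (id1 := 0) (op1 := +%R)).
- by apply: eq_bigr => i _; rewrite bilinZr.
- by move=> u1 u2; rewrite bilinDr.
- exact: bilin0r.
Qed.

Lemma mxform_bilin u v :
  mxform (\matrix_(i, j) h (delta_mx 0 i) (delta_mx 0 j)) u v = h u v.
Proof.
rewrite mxformE bilin_sumr; apply: eq_bigr => i _.
rewrite bilin_suml mulr_sumr; apply: eq_bigr => j _.
by rewrite mxE mulrC mulrA.
Qed.

End Bilinear.

Section Metrics.
Context {R : realType} {n : nat} {M : charted_space R n}.
Context (c : conformal_structure M).
Hypothesis HM : is_manifold M.

Lemma conformal_riemannian (g : tensor02 M) (u : M -> R) :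
  is_riemannian g -> smooth_fun u ->
  is_riemannian (fun x v w => expR (2 * u x) * g x v w).
Proof.
move=> [[gbil gsym gsm] gpos] us; split; last first.
  by move=> x v v0; rewrite mulr_gt0 ?expR_gt0 // gpos.
split.
- move=> x; split=> w a u1 u2 /=.
    by rewrite (bilinDl (gbil x)) (bilinZl (gbil x)) mulrDr mulrCA.
  by rewrite (bilinDr (gbil x)) (bilinZr (gbil x)) mulrDr mulrCA.
- by move=> x v w; rewrite gsym.
- move=> phi aphi v w k; have oI := open_chart_img HM aphi.
  apply: (Ck_mul (f := fun y => expR (2 * u (cinv phi y))) oI _ (gsm phi aphi v
    w k)).
  apply: Ck_expR => //; apply: Ck_mul => //; first exact: Ck_cst.
  exact: us.
Qed.

Lemma metrics_riemannian g : metrics c g -> is_riemannian g.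
Proof.
by case: c => m [g0 rg0 /= ->] [u us ->]; exact: conformal_riemannian.
Qed.

Lemma smooth_fun_sub (u v : M -> R) : smooth_fun u -> smooth_fun v ->
  smooth_fun (fun x => u x - v x).
Proof.
move=> us vs phi aphi k; have oI := open_chart_img HM aphi.
under eq_fun do rewrite /= -mulN1r.
by apply: Ck_add => //; [exact: us|apply: Ck_mul => //;
  [exact: Ck_cst|exact: vs]].
Qed.

(** Both metrics are written relative to the metric that generates the class, and the exponents are
    subtracted. This sharpens the pointwise ratio of two metrics to a smooth factor. *)
Lemma metrics_conformal g g' : metrics c g -> metrics c g' ->
  exists2 u : M -> R, smooth_fun u &
    g' = fun x v w => expR (2 * u x) * g x v w.
Proof.
case: c => m [g0 _ /= ->] [u us ->] [u' us' ->].
exists (fun x => u' x - u x); first exact: smooth_fun_sub.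
apply/funext => x; apply/funext => v; apply/funext => w.
by rewrite mulrA -expRD -mulrDr subrK.
Qed.

End Metrics.

Section AmbientGeometry.
Context {R : realType} {n : nat} {M : charted_space R n}.
Variable delta : R.
Hypothesis HM : is_manifold M.

Let I : set R := `]0, +oo[%classic.
Let J : set R := `]- delta, delta[%classic.
Local Notation AM := (@ambient_space R n M delta).
Local Notation tA := (@ambient_t R n M delta).
Local Notation rA := (@ambient_rho R n M delta).
Local Notation xA := (@ambient_pr R n M delta).

Definition ambient_chart (a : @posR R) (b : line_space J) (phi : chart R M n) :
    chart R AM (1 + (1 + n)) :=
  prod_chart (line_chart (a : I)) (prod_chart (line_chart (b : J)) phi).

Lemma open_posR_set : open I. Proof. exact: interval_open. Qed.
Lemma open_rho_set : open J. Proof. exact: interval_open. Qed.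

Lemma posR_manifold : is_manifold (@posR R).
Proof. exact: (line_manifold open_posR_set). Qed.

Lemma rho_manifold : is_manifold (prod_space (line_space J) M).
Proof. by apply: prod_manifold => //; exact: (line_manifold open_rho_set). Qed.

Lemma ambient_manifold : is_manifold AM.
Proof. exact: (prod_manifold posR_manifold rho_manifold). Qed.

Lemma ambient_atlasP (chi : chart R AM (1 + (1 + n))) : atlas chi <->
  exists a b phi, atlas phi /\ chi = ambient_chart a b phi.
Proof.
split=> [[_ [_ [[a _ <-] [_ [phi [[b _ <-] aphi ->]]] ->]]]|[a [b [phi [aphi
  ->]]]]].
  by exists a, b, phi.
exists (line_chart a), (prod_chart (line_chart b) phi); split=> //;
  first by exists a.
by exists (line_chart b), phi; split=> //; exists b.
Qed.

Lemma ambient_chart_img a b phi : chart_img (ambient_chart a b phi) =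
  [set w | [/\ 0 < tcoord w,
    - delta < rcoord w < delta & chart_img phi (xcoord w)]].
Proof.
rewrite prod_chart_img line_chart_img prod_chart_img line_chart_img.
apply/seteqP; split=> w /=; rewrite !in_itv /= ?andbT.
  by move=> [? [? ?]].
by move=> [? ? ?].
Qed.

Section ChartPoint.
Variables (a : @posR R) (b : line_space J) (phi : chart R M n).
Variable w : 'rV[R]_(1 + (1 + n)).
Hypothesis aphi : atlas phi.
Hypothesis iw : chart_img (ambient_chart a b phi) w.

Lemma ambient_chart_t : tA (cinv (ambient_chart a b phi) w) = tcoord w.
Proof.
move: iw; rewrite ambient_chart_img => -[t0 _ _].
by apply: (val_line_cinv (A := I)); rewrite /I /= in_itv /= andbT.
Qed.

Lemma ambient_chart_rho : rA (cinv (ambient_chart a b phi) w) = rcoord w.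
Proof.
move: iw; rewrite ambient_chart_img => -[_ r0 _].
by apply: (val_line_cinv (A := J)); rewrite /J /= in_itv.
Qed.

Lemma from_ambient_chart u :
  from_chart (ambient_chart a b phi) w u =
  row_mx (lsubmx u) (row_mx (lsubmx (rsubmx u)) (from_chart phi (xcoord w)
    (xcoord u))).
Proof.
have := iw; rewrite ambient_chart_img => -[t0 r0 iphi].
have i1 : I (lsubmx w 0 0) by rewrite /I /= in_itv /= andbT.
have i2 : J (lsubmx (rsubmx w) 0 0) by rewrite /J /= in_itv.
have mJ := line_manifold open_rho_set.
rewrite (from_prod_chart posR_manifold rho_manifold); first last.
- by rewrite prod_chart_img line_chart_img.
- by rewrite line_chart_img.
- by exists (line_chart b), phi; split=> //; exists b.
- by exists a.
rewrite (from_line_chart open_posR_set) //; congr row_mx.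
rewrite (from_prod_chart mJ HM) //; last by rewrite line_chart_img.
  by rewrite (from_line_chart open_rho_set).
by exists b.
Qed.

End ChartPoint.

Lemma to_ambient_chart a b phi (p : AM) u : atlas phi -> cdom phi p.2.2 ->
  to_chart (ambient_chart a b phi) p u =
  row_mx (lsubmx u) (row_mx (lsubmx (rsubmx u)) (to_chart phi p.2.2 (xcoord
    u))).
Proof.
move=> aphi dphi; have mJ := line_manifold open_rho_set.
rewrite (to_prod_chart posR_manifold rho_manifold) //; first last.
- by exists (line_chart b), phi; split=> //; exists b.
- by exists a.
rewrite (to_line_chart open_posR_set); congr row_mx.
rewrite (to_prod_chart mJ HM) //; last by exists b.
by rewrite (to_line_chart open_rho_set).
Qed.

Lemma ambient_chart_atE (p : AM) :
  chart_at p = ambient_chart p.1 p.2.1 (chart_at p.2.2).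
Proof. by []. Qed.

Lemma ambient_base_img (p : AM) : chart_img (chart_at p) (cmap (chart_at p) p).
Proof. by exists p => //; have [] := manifold_chart_atP ambient_manifold p. Qed.

Lemma ambient_base_t (p : AM) : tcoord (cmap (chart_at p) p) = tA p.
Proof. exact: tcoord_row. Qed.

Lemma ambient_base_rho (p : AM) : rcoord (cmap (chart_at p) p) = rA p.
Proof. exact: rcoord_row. Qed.

Lemma ambient_base_x (p : AM) :
  xcoord (cmap (chart_at p) p) = cmap (chart_at (xA p)) (xA p).
Proof. exact: xcoord_row. Qed.

Lemma near_ambient_img (p : AM) :
  \forall w \near cmap (chart_at p) p, chart_img (chart_at p) w.
Proof.
have [a _] := manifold_chart_atP ambient_manifold p.
exact: (near_chart_img ambient_manifold a (ambient_base_img p)).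
Qed.

Lemma is_diff_ambient_t (p : AM) :
  is_diff (cmap (chart_at p) p) (tA \o cinv (chart_at p)) (@tcoord R n).
Proof.
apply: is_diff_near_eq (is_diff_rV_linear _ (@linear_tcoord R n)).
by apply: filterS (near_ambient_img p) => w iw; rewrite [RHS]ambient_chart_t.
Qed.

Lemma is_diff_ambient_rho (p : AM) :
  is_diff (cmap (chart_at p) p) (rA \o cinv (chart_at p)) (@rcoord R n).
Proof.
apply: is_diff_near_eq (is_diff_rV_linear _ (@linear_rcoord R n)).
by apply: filterS (near_ambient_img p) => w iw; rewrite [RHS]ambient_chart_rho.
Qed.

Lemma ambient_cmap_cinv (p : AM) : cinv (chart_at p) (cmap (chart_at p) p) = p.
Proof.
by have [a d] := manifold_chart_atP ambient_manifold p;
  rewrite (chart_cmapK ambient_manifold a d).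
Qed.

Lemma tangent_ambient_pr (p : AM) u :
  @tangent_map R _ _ AM M xA p u = xcoord u.
Proof.
have [ax dx] := manifold_chart_atP HM (xA p).
have /is_diff_near_eq H :=
  is_diff_rV_linear (cmap (chart_at p) p) (@linear_xcoord R n).
have [|_ /(congr1 (@^~ u)) //] := H (cmap (chart_at (xA p)) \o
   xA \o cinv (chart_at p)).
apply: filterS (near_ambient_img p) => w.
rewrite ambient_chart_atE ambient_chart_img => -[_ _ iw].
by have [_ /= ->] := chart_cinvP HM ax iw.
Qed.

Variables (g : tensor02 M) (alpha : R -> endo_field M).

(** The product rule gives d(rho t) = rho dt + t drho. This links the intrinsic definition, through
    differentials and the tangent map of the projection, to the form whose signature is known. *)
Lemma ambient_metricE (p : AM) u v :
  ambient_metric delta g alpha p u v =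
  lorentz_form (tA p) (rA p)
    (fun y z => g (xA p) (alpha (rA p) (xA p) y) z) u v.
Proof.
rewrite /ambient_metric !tangent_ambient_pr /lorentz_form.
have dtE : dfun tA p = tcoord (n := n) by rewrite /dfun;
  have [_ ->] := is_diff_ambient_t p.
have drE : dfun (fun q : AM => rA q * tA q) p =
    fun z => rA p * tcoord z + tA p * rcoord z.
  rewrite /dfun; have := is_diffM (is_diff_ambient_rho p) (is_diff_ambient_t p).
  have -> : (rA \o cinv (chart_at p)) (cmap (chart_at p) p) = rA p.
    exact: congr1 (ambient_cmap_cinv p).
  have -> : (tA \o cinv (chart_at p)) (cmap (chart_at p) p) = tA p.
    exact: congr1 (ambient_cmap_cinv p).
  by move=> [_ ->].
by rewrite dtE drE.
Qed.

End AmbientGeometry.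

(** * The ambient metric is smooth and Lorentzian *)

Section AmbientLorentz.
Context {R : realType} {n : nat} {M : charted_space R n}.
Context (c : conformal_structure M) (delta : R).
Variables (g : tensor02 M) (alpha : R -> endo_field M).
Hypothesis HM : is_manifold M.
Hypothesis cg : metrics c g.
Hypothesis adm : is_admissible c alpha.
Hypothesis nsing : forall rho : R, `|rho| < delta -> nonsingular (alpha rho).

Local Notation AM := (@ambient_space R n M delta).
Local Notation tA := (@ambient_t R n M delta).
Local Notation rA := (@ambient_rho R n M delta).
Local Notation xA := (@ambient_pr R n M delta).
Local Notation gA := (ambient_metric delta g alpha).

Let gbil x : bilinear_for *%R *%R (g x).
Proof. by have [[+ _ _] _] := metrics_riemannian HM cg; exact. Qed.

Let gsym x u v : g x u v = g x v u.
Proof. by have [[_ + _] _] := metrics_riemannian HM cg; exact. Qed.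

Lemma alpha_linear rho x : linear (alpha rho x).
Proof. by have [[+ _] _ _ _] := adm; exact. Qed.

Lemma alpha_formC rho x u v : g x (alpha rho x u) v = g x (alpha rho x v) u.
Proof. by have [_ /(_ g cg rho x u v) -> _ _] := adm; rewrite gsym. Qed.

Lemma alpha_bilinear rho x :
  bilinear_for *%R *%R (fun u v => g x (alpha rho x u) v).
Proof.
split=> w a u v.
  by rewrite alpha_linear; exact: (gbil x).1.
exact: (gbil x).2.
Qed.

Definition alpha_mx x rho : 'M[R]_n :=
  \matrix_(i, j) g x (alpha rho x (delta_mx 0 i)) (delta_mx 0 j).

Lemma mxform_alpha x rho u v :
  mxform (alpha_mx x rho) u v = g x (alpha rho x u) v.
Proof. exact: mxform_bilin (alpha_bilinear rho x) u v. Qed.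

(** Smoothness of the family is joint in [rho] and the chart coordinates; it is restricted to the
    slice through [x], where [endo_rep] in [chart_at x] is [alpha] itself. *)
Lemma alpha_continuous x u : continuous (fun rho => alpha rho x u).
Proof.
have [a d] := manifold_chart_atP HM x.
have [[_ sm] _ _ _] := adm => rho.
pose y := cmap (chart_at x) x.
have iy : chart_img (chart_at x) y by exists x.
have repE r : endo_rep (alpha r) (chart_at x) u y = alpha r x u.
  rewrite /endo_rep (chart_cmapK HM a d).
  by rewrite (to_chart_at HM) (from_chart_at HM).
pose f (w : 'rV[R]_(1 + n)) :=
  endo_rep (alpha (lsubmx w 0 0)) (chart_at x) u (rsubmx w).
pose e (r : R) : 'rV[R]_(1 + n) := row_mx r%:M y.
have -> : (fun r => alpha r x u) = fun r => f (e r).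
  by apply/funext => r; rewrite /f /e row_mxKl row_mxKr mxE eqxx mulr1n repE.
have eC : {for rho, continuous e}.
  apply: (row_mx_continuous_at (f := fun r : R => r%:M : 'rV[R]_1)
    (g := fun _ => y)); last exact: cst_continuous.
  apply: (@Ck_scalar_mx _ _ 0 setT id openT _ _ I) => r _; exact: cvg_id.
apply: (continuous_at_comp eC); apply: (sm _ a u 0).
by rewrite /= /e row_mxKr.
Qed.

Lemma bilin_continuousl x v : continuous (fun u => g x u v).
Proof. by apply: rV_linear_continuous; exact: (gbil x).1. Qed.

Lemma alpha_posdef x rho : `|rho| < delta -> posdef (alpha_mx x rho).
Proof.
move=> rd; apply: posdef_path.
- by move=> r; apply/matrixP => i j; rewrite !mxE alpha_formC.
- move=> i j r.
  have -> : (fun r => alpha_mx x r i j) =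
      fun r => g x (alpha r x (delta_mx 0 i)) (delta_mx 0 j).
    by apply/funext => s; rewrite mxE.
  apply: (continuous_at_comp (f := fun r => alpha r x (delta_mx 0 i))
    (g := fun u => g x u (delta_mx 0 j))).
    exact: alpha_continuous.
  exact: bilin_continuousl.
- split; first by apply/matrixP => i j; rewrite !mxE alpha_formC.
  move=> v v0; rewrite mxform_alpha.
  have [_ _ -> _] := adm; have [_] := metrics_riemannian HM cg; exact.
- move=> s /andP[s0 s1].
  have sr : `|s * rho| < delta.
    rewrite normrM; apply: le_lt_trans rd.
    by rewrite ger0_norm // ler_piMl.
  have [f fK Kf] := nsing sr x.
  rewrite -row_free_unit; apply/inj_row_free => v vG.
  (* A vector in the kernel of the Gram matrix pairs to zero with everything, in particular with its
     own image under [alpha], which therefore vanishes. *)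
  have av0 : alpha (s * rho) x v = 0.
    apply/eqP/negPn/negP => a0.
    have [_ /(_ x _ a0)] := metrics_riemannian HM cg.
    by rewrite -mxform_alpha /mxform vG mul0mx mxE ltxx.
  have a00 : alpha (s * rho) x 0 = 0.
    have := alpha_linear (s * rho) x (-1) 0 0.
    by rewrite scaler0 addr0 scaleN1r addNr.
  by rewrite -(fK v) av0 -a00 fK.
Qed.

Lemma from_chart_linear (phi : chart R M n) y : linear (from_chart phi y).
Proof. by move=> a u v; rewrite /from_chart linearP. Qed.

(** Smoothness of [g] is known only for constant arguments, whereas in the ambient metric the first
    argument is the image under [alpha], which moves with the point. Expanding it in the standard
    basis separates the two dependences. *)
Lemma tensor_rep_suml (phi : chart R M n) u v y :
  tensor_rep g phi u v y = \sum_i u 0 i * tensor_rep g phi (delta_mx 0 i) v y.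
Proof.
rewrite /tensor_rep (@bilin_suml _ _ (fun u v => g (cinv phi y)
  (from_chart phi y u) (from_chart phi y v))) //.
split=> w a z1 z2.
  by rewrite from_chart_linear; exact: (gbil _).1.
by rewrite from_chart_linear; exact: (gbil _).2.
Qed.

Lemma ambient_tensor_rep a b (phi : chart R M n) u v w : atlas phi ->
  chart_img (ambient_chart (delta := delta) a b phi) w ->
  tensor_rep gA (ambient_chart a b phi) u v w =
  lorentz_form (tcoord w) (rcoord w)
    (fun y z => tensor_rep g phi (endo_rep (alpha (rcoord w)) phi y (xcoord w))
      z (xcoord w)) u v.
Proof.
move=> aphi iw; have := iw; rewrite ambient_chart_img => -[_ _ iphi].
rewrite /tensor_rep ambient_metricE // !from_ambient_chart //.
rewrite (ambient_chart_t iw) (ambient_chart_rho iw).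
rewrite /lorentz_form /tcoord /rcoord /xcoord !row_mxKr !row_mxKl.
by rewrite /endo_rep (to_chartK HM).
Qed.

Lemma ambient_metric_smooth (chi : chart R AM (1 + (1 + n))) u v : atlas chi ->
  smooth_on (chart_img chi) (tensor_rep gA chi u v).
Proof.
move=> achi; have oI := open_chart_img (ambient_manifold delta HM) achi.
move: achi oI => /ambient_atlasP[a [b [phi [aphi ->]]]] oI k.
set U := chart_img _ in oI *.
have iphi w : U w -> chart_img phi (xcoord w).
  by rewrite /U ambient_chart_img => -[].
pose f w := lorentz_form (tcoord w) (rcoord w)
    (fun y z => tensor_rep g phi (endo_rep (alpha (rcoord w)) phi y (xcoord w))
      z (xcoord w)) u v.
apply: (Ck_ext (f := f)) => //.
  by move=> w iw; apply/esym; exact: ambient_tensor_rep.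
have tC : Ck k U (@tcoord R n) by apply: Ck_rV_linear; exact: linear_tcoord.
have rC : Ck k U (@rcoord R n) by apply: Ck_rV_linear; exact: linear_rcoord.
have cC (r : R) : Ck k U (fun=> r) by exact: Ck_cst.
have [[_ sm] _ _ _] := adm; have [[_ _ gsm] _] := metrics_riemannian HM cg.
apply: Ck_add => //; first apply: Ck_add => //; apply: Ck_mul => //.
- by apply: Ck_add => //; apply: Ck_mul.
- by apply: Ck_add => //; apply: Ck_mul.
- by apply: (Ck_mul (f := @tcoord R n) (g := @tcoord R n)).
under eq_fun do rewrite tensor_rep_suml.
apply: Ck_sum => // i; apply: Ck_mul => //.
  apply: Ck_coord => //.
  have := Ck_comp_rV_linear (@linear_rsubmx R 1 (1 + n)) (sm phi aphi (xcoord
    u) k).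
  by apply: Ck_sub => w /iphi.
have := Ck_comp_rV_linear (@linear_xcoord R n) (gsm phi aphi (delta_mx 0 i)
  (xcoord v) k).
by apply: Ck_sub => w /iphi.
Qed.

Lemma lorentz_form_bilinear (t r : R) (G : 'rV[R]_n -> 'rV[R]_n -> R) :
  bilinear_for *%R *%R G -> bilinear_for *%R *%R (lorentz_form t r G).
Proof.
move=> Gb; split=> w a u v;
  rewrite /lorentz_form /= linear_tcoord linear_rcoord linear_xcoord.
  by rewrite (bilinDl Gb) (bilinZl Gb) /GRing.scale /=; ring.
by rewrite (bilinDr Gb) (bilinZr Gb) /GRing.scale /=; ring.
Qed.

Lemma ambient_rho_lt (p : AM) : `|rA p| < delta.
Proof.
have := valP p.2.1; rewrite inE /= in_itv /= => /andP[d1 d2].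
by rewrite ltr_norml d1.
Qed.

Lemma ambient_lorentzian : @is_lorentzian R n.+1 AM gA.
Proof.
split; first split.
- move=> p; have := @lorentz_form_bilinear (tA p) (rA p) _ (alpha_bilinear (rA
  p) (xA p)).
  by move=> [H1 H2]; split=> w a u v; rewrite !ambient_metricE //;
    [exact: H1|exact: H2].
- move=> p u v; rewrite !ambient_metricE // /lorentz_form alpha_formC; ring.
- by move=> chi achi u v; exact: ambient_metric_smooth.
move=> p.
have := lorentz_form_signature (rA p) (pos_gt0 p.1) (alpha_posdef (xA p)
  (ambient_rho_lt p)).
congr has_signature; apply/funext => u; apply/funext => v.
by rewrite ambient_metricE // /lorentz_form mxform_alpha.
Qed.

End AmbientLorentz.

(** * The action and the Lie derivative *)

Section AtBasePoint.
Context {R : realType} {n : nat} {X : charted_space R n}.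
Hypothesis HX : is_manifold X.

Lemma tensor_rep_at (T : tensor02 X) (x : X) u v :
  tensor_rep T (chart_at x) u v (cmap (chart_at x) x) = T x u v.
Proof.
have [a d] := manifold_chart_atP HX x.
by rewrite /tensor_rep !(from_chart_at HX) (chart_cmapK HX a d).
Qed.

Lemma endo_rep_at (A : endo_field X) (x : X) u :
  endo_rep A (chart_at x) u (cmap (chart_at x) x) = A x u.
Proof.
have [a d] := manifold_chart_atP HX x.
by rewrite /endo_rep (from_chart_at HX) (chart_cmapK HX a d) (to_chart_at HX).
Qed.

End AtBasePoint.

Lemma derive_line {R : realType} {V W : normedModType R} (f : V ->
  W) (x v : V) :
  'D_v f x = 'D_1 (fun h : R => f (h *: v + x)) 0.
Proof.
rewrite /derive; apply: (congr1 (fun F => lim (F @ 0^'))).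
apply/funext => h /=.
by rewrite scale0r add0r addr0 [h *: 1]mulr1.
Qed.

(** Along suitable lines, the metric coefficients and the t-component of the embedding are
    polynomials of this shape. *)
Lemma derive_quadratic {R : realType} (a b c : R) :
  'D_1 (fun h : R => a + b * h + c * h ^+ 2) 0 = b.
Proof.
have := is_deriveD (is_deriveD (is_derive_cst a (0 : R) 1)
  (is_deriveZ b (is_derive_id (0 : R) 1))) (is_deriveZ c (is_deriveX 2
    (is_derive_id (0 : R) 1))).
case=> _; rewrite [X in _ = X -> _](_ : _ = b); first exact.
by rewrite add0r /GRing.scale /= expr1 !mulr0 mul0r mulr0 addr0 mulr1.
Qed.

Section AmbientAction.
Context {R : realType} {n : nat} {M : charted_space R n}.
Context (c : conformal_structure M) (delta : R).
Variables (g : tensor02 M) (alpha : R -> endo_field M).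
Hypothesis HM : is_manifold M.
Hypothesis cg : metrics c g.
Hypothesis adm : is_admissible c alpha.

Local Notation AM := (@ambient_space R n M delta).
Local Notation tA := (@ambient_t R n M delta).
Local Notation rA := (@ambient_rho R n M delta).
Local Notation xA := (@ambient_pr R n M delta).
Local Notation gA := (ambient_metric delta g alpha).
Local Notation act := (@ambient_act R n M delta).

(** The coordinate field d/dt; it is constant because t is the same global coordinate in every
    chart. *)
Definition dt_vector : 'rV[R]_(1 + (1 + n)) := row_mx 1%:M (row_mx 0%:M 0).

Lemma tcoord_dt a w : tcoord (a *: dt_vector + w) = a + tcoord w.
Proof. by rewrite linear_tcoord tcoord_row [a *: 1]mulr1. Qed.

Lemma rcoord_dt a w : rcoord (a *: dt_vector + w) = rcoord w.
Proof. by rewrite linear_rcoord rcoord_row scaler0 add0r. Qed.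

Lemma xcoord_dt a w : xcoord (a *: dt_vector + w) = xcoord w.
Proof. by rewrite linear_xcoord xcoord_row scaler0 add0r. Qed.

(** In coordinates the orbit of [p] is an affine function of exp(s), whose linear part is its
    velocity at s = 0: the field is t d/dt. *)
Lemma ambient_fundamental_field (p : AM) :
  fundamental_field act p = tA p *: dt_vector.
Proof.
rewrite /fundamental_field derive1E.
pose e := tA p *: dt_vector.
pose b : 'rV[R]_(1 + (1 + n)) :=
  row_mx 0%:M (row_mx (rA p)%:M (cmap (chart_at (xA p)) (xA p))).
have -> : (fun s : R => cmap (chart_at p) (act (posexp s) p)) =
   (( *:%R ^~ e) \o (expR : R -> R)) + cst b.
  apply/funext => s; rewrite -[RHS]/(expR s *: e + b) /e /b /dt_vector scalerA.
  rewrite !scale_row_mx !add_row_mx scale_scalar_mx mulr1 -raddfD addr0 /=.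
  by rewrite scaler0 add0r scale_scalar_mx mulr0 -raddfD add0r.
have eD : is_diff (0 : R) expR ('d expR (0 : R)).
  by apply: differentiableP; apply/derivable1_diffP/derivable_expR.
have D := is_diffD (is_diff_comp eD (is_diff_scalel (expR (0 : R)) e))
  (is_diff_cst b (0 : R)).
rewrite (is_diff_derive (1 : R) D).
have -> : (( *:%R ^~ e) \o 'd expR (0 : R) + 0 : R ->
  _) 1 = 'd expR (0 : R) 1 *: e + 0 by [].
rewrite -deriveE; last by apply/derivable1_diffP/derivable_expR.
by rewrite derive_val expR0 scale1r addr0.
Qed.

(** Needed on the whole chart image, since the Lie derivative differentiates the field. The
    M-component is zero, so the linear change of coordinates on M has no effect on it. *)
Lemma ambient_vector_rep (p : AM) w : chart_img (chart_at p) w ->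
  vector_rep (fundamental_field act) (chart_at p) w = tcoord w *: dt_vector.
Proof.
have [ap _] := manifold_chart_atP (ambient_manifold delta HM) p.
have [ax _] := manifold_chart_atP HM (xA p).
move=> iw; rewrite /vector_rep ambient_fundamental_field.
have -> : tA (cinv (chart_at p) w) = tcoord w by exact: ambient_chart_t.
have [d _] := chart_cinvP (ambient_manifold delta HM) ap iw.
rewrite [LHS](to_ambient_chart HM _ _ _ ax); last by case: d => _ [].
have x0 : xcoord (tcoord w *: dt_vector) = 0.
  by rewrite -[_ *: _]addr0 xcoord_dt /xcoord !linear0.
rewrite x0 /to_chart linear0 -[RHS]hsubmxK; congr row_mx.
by rewrite -[RHS]hsubmxK; congr row_mx; exact/esym.
Qed.

Lemma is_diff_ambient_vector_rep (p : AM) :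
  is_diff (cmap (chart_at p) p) (vector_rep (fundamental_field act) (chart_at
    p))
    (fun u => tcoord u *: dt_vector).
Proof.
apply: (@is_diff_near_eq _ _ _ (fun w => tcoord w *: dt_vector)).
  by apply: filterS (near_ambient_img HM p) => w iw; rewrite ambient_vector_rep.
apply: is_diff_rV_linear => a u v.
by rewrite linear_tcoord scalerDl scalerA.
Qed.

Lemma derive_ambient_tensor (p : AM) u v :
  'D_(tA p *: dt_vector) (tensor_rep gA (chart_at p) u v) (cmap (chart_at p) p)
    =
  tA p * (rcoord u * tcoord v + tcoord u * rcoord v)
  + 2 * (tA p ^+ 2 * g (xA p) (alpha (rA p) (xA p) (xcoord u)) (xcoord v)).
Proof.
have [ap _] := manifold_chart_atP (ambient_manifold delta HM) p.
have [ax _] := manifold_chart_atP HM (xA p).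
set Q := g _ _ _; set y := cmap _ _.
pose f w := lorentz_form (tcoord w) (rcoord w)
  (fun y z => tensor_rep g (chart_at (xA p))
     (endo_rep (alpha (rcoord w)) (chart_at (xA p)) y (xcoord w)) z (xcoord w))
       u v.
rewrite (@near_eq_derive _ _ _ _ f); last first.
  by apply: filterS (near_ambient_img HM p) => w iw;
    rewrite [LHS](ambient_tensor_rep g alpha HM u v ax iw).
rewrite derive_line.
pose B := tA p * (rcoord u * tcoord v + tcoord u * rcoord v)
  + 2 * (tA p ^+ 2 * Q).
pose A := lorentz_form (tA p) (rA p) (fun _ _ => Q) u v.
(* Along this line only t moves, to t (1 + h), so the g-part is quadratic in [h] and the plane part
   affine. *)
have -> : (fun h : R => f (h *: (tA p *: dt_vector) + y)) =
    (fun h => A + B * h + (tA p ^+ 2 * Q) * h ^+ 2).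
  apply/funext => h; rewrite /f scalerA tcoord_dt rcoord_dt xcoord_dt.
  rewrite /y ambient_base_t ambient_base_rho ambient_base_x /lorentz_form.
  rewrite (tensor_rep_at HM) (endo_rep_at HM) -/Q /A /B /lorentz_form; ring.
exact: derive_quadratic.
Qed.

(** The derivative of the field along [u] is dt(u) d/dt, whose pairing with [v] is 2 rho dt(u) dt(v)
    + t dt(u) drho(v). With its mirror image it supplies the rho-terms, which the derivative of the
    coefficients lacks, and the second copy of the mixed terms; the g-part is already doubled. *)
Lemma ambient_lie_derivative (p : AM) u v :
  lie_derivative (fundamental_field act) gA p u v = 2 * gA p u v.
Proof.
rewrite /lie_derivative (is_diff_derive _ (is_diff_ambient_vector_rep p)).
rewrite (is_diff_derive _ (is_diff_ambient_vector_rep p)).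
rewrite (ambient_vector_rep (ambient_base_img HM p)) ambient_base_t.
rewrite derive_ambient_tensor !(tensor_rep_at (ambient_manifold delta HM)).
rewrite !ambient_metricE // /lorentz_form.
have ab := alpha_bilinear HM cg adm (rA p) (xA p).
rewrite -[tcoord u *: _]addr0 -[tcoord v *: _]addr0 !tcoord_dt !rcoord_dt
  !xcoord_dt.
have -> : tcoord (0 : 'rV[R]_(1 + (1 + n))) = 0 by rewrite /tcoord !linear0 mxE.
have -> : rcoord (0 : 'rV[R]_(1 + (1 + n))) = 0 by rewrite /rcoord !linear0 mxE.
have -> : xcoord (0 : 'rV[R]_(1 + (1 + n))) = 0 by rewrite /xcoord !linear0.
rewrite (bilin0l ab) (bilin0r ab); ring.
Qed.

End AmbientAction.

(** * Freeness and smoothness of the action *)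

Section AmbientFreeAction.
Context {R : realType} {n : nat} {M : charted_space R n}.
Variable delta : R.
Hypothesis HM : is_manifold M.

Local Notation AM := (@ambient_space R n M delta).
Local Notation tA := (@ambient_t R n M delta).
Local Notation rA := (@ambient_rho R n M delta).
Local Notation xA := (@ambient_pr R n M delta).
Local Notation act := (@ambient_act R n M delta).

Lemma Ck_ambient_chart (V : normedModType R) k (U : set V) (F : V -> AM) a b
    (phi : chart R M n) : open U ->
  Ck k U (fun w => tA (F w)) -> Ck k U (fun w => rA (F w)) ->
  Ck k U (fun w => cmap phi (xA (F w))) ->
  Ck k U (fun w => cmap (ambient_chart (delta := delta) a b phi) (F w)).
Proof.
move=> oU tC rC xC; apply: Ck_row_mx => //; first exact: Ck_scalar_mx.
by apply: Ck_row_mx => //; exact: Ck_scalar_mx.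
Qed.

Lemma ambient_act_continuous :
  continuous (fun p : prod_space posR AM => act p.1 p.2).
Proof.
move=> p; apply: (continuous_at_pair
  (f := fun p : prod_space posR AM => posM p.1 p.2.1 : (`]0,
    +oo[%classic : set R))
  (g := fun p : prod_space posR AM => p.2.2)).
  apply: continuous_into_subset.
  apply: (@continuousM _ _ (fun p : prod_space posR AM => val p.1)
    (fun p : prod_space posR AM => val p.2.1)).
    by apply: continuous_at_comp; [exact: cvg_fst|exact: continuous_subset_val].
  apply: continuous_at_comp; last exact: continuous_subset_val.
  by apply: (continuous_at_comp (f := snd)); [exact: cvg_snd|exact: cvg_fst].
by apply: (continuous_at_comp (f := snd)); [exact: cvg_snd|exact: cvg_snd].
Qed.

(** In charts the t-component is a product of two coordinates, the rho-component is a coordinate,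
    and the M-component is a transition map of M after a linear projection. *)
Lemma ambient_act_smooth :
  @smooth_map R _ _ (prod_space posR AM) AM (fun p => act p.1 p.2).
Proof.
split; first exact: ambient_act_continuous.
have HA := ambient_manifold delta HM.
have HP := prod_manifold (@posR_manifold R) HA.
move=> _ chi' [_ [chi [[s _ <-] achi ->]]] achi' k.
have achi2 : atlas (prod_chart (line_chart s) chi : chart R (prod_space posR
  AM) _).
  by exists (line_chart s), chi; split=> //; exists s.
have oP : open ((fun p : prod_space posR AM => act p.1 p.2) @^-1` cdom chi').
  by apply: open_comp (open_cdom HA achi') => p _;
    exact: ambient_act_continuous.
have oU := open_chart_imgI HP achi2 oP.
set U := cmap _ @` _ in oU *.
have /ambient_atlasP[a [b [phi [aphi chiE]]]] := achi.
have /ambient_atlasP[a' [b' [phi' [aphi' chiE']]]] := achi'.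
have UP w : U w -> [/\ 0 < lsubmx w 0 0, chart_img chi (rsubmx w),
    chart_img phi (xcoord (rsubmx w)) & cdom phi' (cinv phi (xcoord (rsubmx
      w)))].
  rewrite /U (chart_imgI HP) // prod_chart_img line_chart_img => -[/= [s0 ic]].
  have := ic; rewrite chiE ambient_chart_img => -[t0 r0 iphi].
  rewrite chiE' => -[_ [_ dphi']]; split=> //.
  by move: s0; rewrite in_itv /= andbT.
pose x (w : 'rV[R]_(1 + (1 + (1 + n)))) := xcoord (rsubmx w).
have linx : linear x.
  by move=> c u v; rewrite /x -linear_xcoord; congr xcoord;
    exact: linear_rsubmx.
rewrite chiE'; apply: (Ck_ambient_chart (F :=
  fun w => act (cinv (line_chart s) (lsubmx w)) (cinv chi (rsubmx w)))) => //.
- apply: (Ck_ext (f := fun w => lsubmx w 0 0 * tcoord (rsubmx w))) => //.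
    move=> w /UP[s0 ic _ _];
      rewrite -[RHS]/(val (cinv (line_chart s) (lsubmx w)) * tA (cinv chi
        (rsubmx w))).
    rewrite (val_line_cinv (A := `]0, +oo[%classic)); last first.
      by rewrite /= in_itv /= andbT.
    by rewrite chiE ambient_chart_t // -chiE.
  apply: Ck_mul => //; apply: Ck_rV_linear => c u v; first by rewrite !mxE.
  by rewrite -linear_tcoord; congr tcoord; exact: linear_rsubmx.
- apply: (Ck_ext (f := fun w => rcoord (rsubmx w))) => //.
    move=> w /UP[s0 ic _ _]; rewrite -[RHS]/(rA (cinv chi (rsubmx w))).
    by rewrite chiE ambient_chart_rho // -chiE.
  apply: Ck_rV_linear => c u v.
  by rewrite -linear_rcoord; congr rcoord; exact: linear_rsubmx.
- apply: (Ck_ext (f := fun w => cmap phi' (cinv phi (x w)))) => //.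
    by move=> w _; rewrite chiE.
  have := Ck_comp_rV_linear linx (smooth_transition HM aphi aphi' k).
  by apply: Ck_sub => w /UP[_ _ i d].
Qed.

Lemma ambient_free_action : @smooth_free_action R _ AM act.
Proof.
split; last exact: ambient_act_smooth.
- move=> [t y]; congr pair; apply: val_inj; exact: mul1r.
- move=> s t [t' y]; congr pair; apply: val_inj; exact/esym/mulrA.
- move=> t [t' y] [/(congr1 val) /= tt'].
  apply: val_inj => /=; apply: (mulIf (lt0r_neq0 (pos_gt0 t'))).
  by rewrite mul1r.
Qed.

End AmbientFreeAction.

(** * The scale bundle and its embedding *)

Section SmoothFun.
Context {R : realType} {n : nat} {M : charted_space R n}.
Hypothesis HM : is_manifold M.

Lemma smooth_fun_continuous (u : M -> R) : smooth_fun u -> continuous u.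
Proof.
move=> us x; have [a d] := manifold_chart_atP HM x.
have iy : chart_img (chart_at x) (cmap (chart_at x) x) by exists x.
have := continuous_at_comp (cmap_continuous HM a d) (us _ a 0 _ iy).
rewrite /prop_for /continuous_at /= (chart_cmapK HM a d).
have E : \forall y \near x, (u \o cinv (chart_at x)) (cmap (chart_at x) y) =
  u y.
  by apply: filterS (near_cdom HM a d) => y dy /=;
    rewrite (chart_cmapK HM a dy).
by apply: cvg_trans; apply: near_eq_cvg; apply: filterS E => y <-.
Qed.

End SmoothFun.

Section ScaleBundle.
Context {R : realType} {n : nat} {M : charted_space R n}.
Context (c : conformal_structure M).
Hypothesis HM : is_manifold M.
Hypothesis n_gt0 : (0 < n)%N.

Local Notation Q := (scale_bundle c).

Lemma scale_bundle_eq (q q' : Q) : foot q = foot q' -> sform q = sform q' ->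
  q = q'.
Proof.
case: q q' => x h H [x' h' H'] /= xx' hh'; subst x' h'.
by rewrite (Prop_irrelevance H H').
Qed.

Lemma ray_coord_unique (g : tensor02 M) (q : Q) (t : posR) : metrics c g ->
  (sform q = fun v w => val t ^+ 2 * g (foot q) v w) -> ray_coord g q = t.
Proof.
move=> cg qt; have := ray_coordP q cg; rewrite qt => E; apply/val_inj/esym.
have [_ gpos] := metrics_riemannian HM cg.
(* Positive dimension supplies a nonzero vector; evaluating there reduces the claim to equality of
   squares of positive numbers. *)
pose v : 'rV[R]_n := const_mx 1.
have v0 : v != 0.
  apply/eqP => /rowP/(_ (Ordinal n_gt0)); rewrite !mxE => /eqP.
  by rewrite oner_eq0.
have := congr1 (fun h => h v v) E => /= /(mulIf (lt0r_neq0 (gpos (foot q) v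
  v0))).
by move/eqP; rewrite eqrXn2 // ?ltW ?pos_gt0 // => /eqP.
Qed.

(** If t is the coordinate for [g'], then t^2 g' = (t exp(u))^2 g. This is how charts built on
    different metrics of the class are compared. *)
Lemma ray_coord_conformal (g g' : tensor02 M) (u : M -> R) (q : Q) :
  metrics c g -> metrics c g' ->
  (g' = fun x v w => expR (2 * u x) * g x v w) ->
  val (ray_coord g q) = val (ray_coord g' q) * expR (u (foot q)).
Proof.
move=> cg cg' g'E.
rewrite (@ray_coord_unique g q (posM (ray_coord g' q) (posexp (u (foot q)))))
  //.
rewrite (ray_coordP q cg'); apply/funext => v; apply/funext => w /=.
have -> : g' (foot q) v w =
  expR (2 * u (foot q)) * g (foot q) v w by rewrite g'E.
by rewrite mulrA exprMn -(expRM_natl 2).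
Qed.

Lemma ray_coord_act (g : tensor02 M) (tau : posR) (q : Q) : metrics c g ->
  ray_coord g (scale_act tau q) = posM tau (ray_coord g q).
Proof.
move=> cg; apply: ray_coord_unique => //=; rewrite (ray_coordP q cg).
by apply/funext => v; apply/funext => w /=; rewrite mulrA exprMn.
Qed.

Lemma open_trivialization (g : tensor02 M) (B : set (prod_space posR M)) :
  metrics c g -> open B -> open (trivialization g @^-1` B : set Q).
Proof.
move=> cg oB; exists [set trivialization g @^-1` B : set Q]; last first.
  by rewrite predeqE => q; split=> [[_ ->]|] //;
    exists (trivialization g @^-1` B).
move=> _ ->; by apply: finI_from1; exists g, B.
Qed.

Lemma trivialization_continuous (g : tensor02 M) : metrics c g ->
  continuous (trivialization g : Q -> prod_space posR M).
Proof. by move=> cg; apply/continuousP => B; exact: open_trivialization. Qed.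

(** The universal property of the topology generated by the trivializations, by unfolding an open
    set into finite intersections of subbasic ones. *)
Lemma continuous_into_scale (T : topologicalType) (f : T -> Q) :
  (forall g, metrics c g -> continuous (fun t => trivialization g (f t))) ->
  continuous f.
Proof.
move=> fC t A; rewrite nbhsE => -[B [oB Bft] BA].
case: oB => D sD DE; move: Bft; rewrite -DE => -[E DEE Et].
apply: (@filterS _ _ _ (f @^-1` E)).
  by move=> s Es; apply: BA; rewrite -DE; exists E.
have [F sF FE] := sD _ DEE; move: Et; rewrite -FE => Et.
rewrite preimage_bigcap; apply: filter_bigI => G FG; have Gt := Et _ FG.
have /sF := FG; rewrite inE => -[g [B' [cg oB' GE]]].
move: Gt; rewrite GE => Gt.
by apply: (fC g cg t); apply: open_nbhs_nbhs.
Qed.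

End ScaleBundle.

(** * The scale bundle embeds, and the metric pulls back to the tautological form *)

Section Embedding.
Context {R : realType} {n : nat} {M : charted_space R n}.
Context (c : conformal_structure M) (delta : R) (delta_gt0 : 0 < delta).
Variables (g : tensor02 M) (alpha : R -> endo_field M).
Hypothesis HM : is_manifold M.
Hypothesis n_gt0 : (0 < n)%N.
Hypothesis cg : metrics c g.

Local Notation Q := (scale_space c).
Local Notation AM := (@ambient_space R n M delta).
Local Notation tA := (@ambient_t R n M delta).
Local Notation rA := (@ambient_rho R n M delta).
Local Notation xA := (@ambient_pr R n M delta).
Local Notation gA := (ambient_metric delta g alpha).
Local Notation iota := (@ambient_embedding R n M c delta delta_gt0 g).

Lemma embedding_injective : injective iota.
Proof.
move=> q q' [/(congr1 val) /= tt' xx']; apply: scale_bundle_eq => //.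
have E : ray_coord g q = ray_coord g q' by exact: val_inj.
by rewrite (ray_coordP q cg) (ray_coordP q' cg) E xx'.
Qed.

Lemma embedding_equivariant tau (q : Q) :
  iota (scale_act tau q) = ambient_act delta tau (iota q).
Proof. by rewrite /ambient_embedding (ray_coord_act HM n_gt0). Qed.

Lemma embedding_continuous : continuous iota.
Proof.
move=> q; have tC := @trivialization_continuous _ _ _ c g cg q.
apply: (continuous_at_pair (f := fun q : Q => ray_coord g q)
  (g := fun q : Q => (exist _ 0 (rho0_subproof delta_gt0), foot q)
     : prod_space (line_space `]- delta, delta[%classic) M)).
  exact: (continuous_at_comp tC (@cvg_fst _ _ _ _ _)).
apply: continuous_at_pair; first exact: cst_continuous.
exact: (continuous_at_comp tC (@cvg_snd _ _ _ _ _)).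
Qed.

Fact scale_section_subproof (p : prod_space posR M) :
  exists2 g', metrics c g' & (fun v w => val p.1 ^+ 2 * g p.2 v w) = g' p.2.
Proof.
by exists (fun x v w => val p.1 ^+ 2 * g x v w) => //;
  apply: metrics_rescale => //; exact: pos_gt0.
Qed.

(** The inverse of [trivialization g]. *)
Definition scale_section (p : prod_space posR M) : Q :=
  ScalePoint (scale_section_subproof p).

Lemma ray_coord_section p : ray_coord g (scale_section p) = p.1.
Proof. exact: ray_coord_unique. Qed.

Lemma scale_sectionK (q : Q) : scale_section (trivialization g q) = q.
Proof. by apply: scale_bundle_eq => //=; rewrite (ray_coordP q cg). Qed.

(** Continuity into Q has to be tested in the trivialization of every metric [g'] of the class;
    there the section reads (t, x) to (t exp(u(x)), x) with [u] smooth. *)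
Lemma scale_section_continuous : continuous scale_section.
Proof.
apply: continuous_into_scale => g' cg'.
have [u us gE] := metrics_conformal HM cg' cg.
move=> p; apply: (continuous_at_pair
  (f := fun p => ray_coord g' (scale_section p)) (g := snd));
    last exact: cvg_snd.
apply: continuous_into_subset.
have -> : (fun p => val (ray_coord g' (scale_section p))) =
    fun p : prod_space posR M => val p.1 * expR (u p.2).
  apply/funext => p'.
  by rewrite (ray_coord_conformal HM n_gt0 _ cg' cg gE) ray_coord_section.
apply: (@continuousM _ _ (fun p : prod_space posR M => val p.1)
  (fun p : prod_space posR M => expR (u p.2))).
  by apply: (continuous_at_comp (f := fst));
    [exact: cvg_fst|exact: continuous_subset_val].
apply: (continuous_at_comp (f := fun p : prod_space posR M => u p.2)).
  by apply: (continuous_at_comp (f := snd));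
    [exact: cvg_snd|exact: smooth_fun_continuous].
exact: continuous_expR.
Qed.

(** Forgetting rho and applying the section is a continuous left inverse of [iota], defined on the
    whole ambient space; its preimage of [A] is the required open set. *)
Lemma embedding_initial (A : set Q) : open A ->
  exists2 B : set AM, open B & A = iota @^-1` B.
Proof.
move=> oA; exists [set p : AM | A (scale_section (p.1, p.2.2))]; last first.
  by apply/seteqP; split=> q /=; rewrite -[(ray_coord g q,
    _)]/(trivialization g q) scale_sectionK.
apply: (@open_comp _ _ (fun p : AM => scale_section (p.1, p.2.2))) => // p _.
apply: (continuous_at_comp (f := fun p : AM => (p.1,
  p.2.2) : prod_space posR M)).
  apply: continuous_at_pair; first exact: cvg_fst.
  by apply: (continuous_at_comp (f := snd)); [exact: cvg_snd|exact: cvg_snd].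
exact: scale_section_continuous.
Qed.

Section Chart.
Variables (g' : tensor02 M) (phi : chart R M n) (q0 : Q).
Hypothesis cg' : metrics c g'.
Hypothesis aphi : atlas phi.

Local Notation sc := (scale_chart g' phi q0).

(** For a positive first coordinate the set searched by [xget] is inhabited, by that coordinate
    squared times [g'], so the default [q0] never appears. *)
Lemma scale_chart_cinvP (w : 'rV[R]_(1 + n)) :
  0 < lsubmx w 0 0 -> 
  foot (cinv sc w) = cinv phi (rsubmx w) /\
  val (ray_coord g' (cinv sc w)) = lsubmx w 0 0.
Proof.
move=> w0 /=; case: xgetP => [q _ [fq sq]|].
  split=> //.
  by rewrite (@ray_coord_unique _ _ _ c HM n_gt0 g' q (mkpos w0)).
have H : exists2 g'', metrics c g'' &
    (fun u v => lsubmx w 0 0 ^+ 2 * g' (cinv phi (rsubmx w)) u v) =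
      g'' (cinv phi (rsubmx w)).
  by exists (fun x u v => lsubmx w 0 0 ^+ 2 * g' x u v) => //;
    exact: metrics_rescale.
by move=> /(_ (ScalePoint H)) [].
Qed.

Lemma scale_chart_img (B : set M) :
  cmap sc @` (cdom sc `&` (@foot _ _ M c) @^-1` B) =
  [set w | 0 < lsubmx w 0 0 /\ (cmap phi @` (cdom phi `&` B)) (rsubmx w)].
Proof.
rewrite (chart_imgI HM) //; apply/seteqP;
  split=> [_ [q [/= dq Bq] <-]|w [/= w0 [ir Br]]] /=.
  rewrite row_mxKl row_mxKr mxE eqxx mulr1n; split; first exact: pos_gt0.
  by split; [exists (foot q)|rewrite (chart_cmapK HM)].
have [f r] := scale_chart_cinvP w0; have [d k] := chart_cinvP HM aphi ir.
exists (cinv sc w); first by rewrite /= f.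
rewrite -[LHS]/(row_mx (val (ray_coord g' (cinv sc w)))%:M (cmap phi (foot
  (cinv sc w)))).
rewrite f r k -[RHS]hsubmxK; congr row_mx.
by apply/rowP => i; rewrite !ord1 [LHS]mxE eqxx mulr1n.
Qed.

Lemma open_scale_chart_img (B : set M) : open B ->
  open [set w : 'rV[R]_(1 + n) |
     0 < lsubmx w 0 0 /\ (cmap phi @` (cdom phi `&` B)) (rsubmx w)].
Proof.
move=> oB; apply: openI.
  apply: (@open_comp _ _ (fun w : 'rV[R]_(1 + n) => lsubmx w 0 0) [set x | 0 <
    x]).
    by move=> w _; apply: rV_linear_continuous => a u v; rewrite !mxE.
  exact: open_gt.
apply: (@open_comp _ _ (fun w : 'rV[R]_(1 + n) => rsubmx w)).
  by move=> w _; exact: continuous_rsubmx.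
exact: open_chart_imgI.
Qed.

Lemma embedding_chart_Ck k a b (phi' : chart R M n) : atlas phi' ->
  Ck k [set w : 'rV[R]_(1 + n) |
     0 < lsubmx w 0 0 /\ (cmap phi @` (cdom phi `&` cdom phi')) (rsubmx w)]
    (cmap (ambient_chart (delta := delta) a b phi') \o iota \o cinv sc).
Proof.
move=> aphi'; have oU := open_scale_chart_img (open_cdom HM aphi').
set U := [set w | _] in oU *.
have [u us g'E] := metrics_conformal HM cg cg'.
have US : U `<=` (fun w : 'rV[R]_(1 + n) => rsubmx w) @^-1` chart_img phi.
  by move=> w [_ [x [dx _] xE]]; exists x.
apply: (Ck_ambient_chart (F := iota \o cinv sc)) => //.
- apply: (Ck_ext (f :=
  fun w => lsubmx w 0 0 * expR (u (cinv phi (rsubmx w))))) => //.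
    move=> w [w0 _]; have [f r] := scale_chart_cinvP w0.
    by rewrite -[RHS]/(val (ray_coord g (cinv sc w))) (ray_coord_conformal HM
      n_gt0 _ cg cg' g'E) f r.
  apply: Ck_mul => //; first by apply: Ck_rV_linear => c' v w; rewrite !mxE.
  apply: Ck_expR => //.
  by have := Ck_comp_rV_linear (@linear_rsubmx R 1 n) (us phi aphi k);
    apply: Ck_sub.
- exact: Ck_cst.
- apply: (Ck_ext (f := fun w => cmap phi' (cinv phi (rsubmx w)))) => //.
    move=> w [w0 _]; have [f r] := scale_chart_cinvP w0.
    by rewrite -[RHS]/(cmap phi' (foot (cinv sc w))) f.
  have := Ck_comp_rV_linear (@linear_rsubmx R 1 n) (smooth_transition HM aphi
    aphi' k).
  by apply: Ck_sub => w [_]; rewrite chart_imgI.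
Qed.

End Chart.

Lemma embedding_smooth : smooth_map iota.
Proof.
split; first exact: embedding_continuous.
move=> _ chi' [g' [phi [q0 [cg' aphi ->]]]] /ambient_atlasP[a [b [phi' [aphi'
  ->]]]] k.
have := embedding_chart_Ck q0 cg' aphi k a b aphi'.
rewrite -(scale_chart_img q0 cg' aphi); congr (Ck _ (_ @` (_ `&` _)) _).
by apply/seteqP; split=> [q dq|q [_ [_ dq]]] //; split=> //; split.
Qed.

(** The metric behind [chart_at q] results from a choice and need not be [g]; tangent vectors of Q
    at [q] are coordinates relative to it. *)
Lemma scale_chart_atP (q : Q) : exists2 g', metrics c g' &
  chart_at q = scale_chart g' (chart_at (foot q)) q.
Proof. by rewrite /=; case: (cid2 (sformP q)) => g' cg' E; exists g'. Qed.

Lemma near_scale_chart (g' : tensor02 M) (phi : chart R M n) (q : Q) :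
  atlas phi -> cdom phi (foot q) ->
  \forall w \near cmap (scale_chart g' phi q) q,
    0 < lsubmx (w : 'rV[R]_(1 + n)) 0 0 /\
      (cmap phi @` (cdom phi `&` cdom phi)) (rsubmx w).
Proof.
move=> aphi d; apply: open_nbhs_nbhs; split.
  exact: open_scale_chart_img (open_cdom HM aphi).
rewrite /= row_mxKl row_mxKr mxE eqxx mulr1n; split; first exact: pos_gt0.
by exists (foot q).
Qed.

Lemma tangent_foot (q : Q) xi :
  @tangent_map _ _ _ Q M (@foot _ _ M c) q xi = rsubmx xi.
Proof.
have [a d] := manifold_chart_atP HM (foot q).
have [g' cg' qE] := scale_chart_atP q; rewrite /tangent_map qE.
have H : is_diff (cmap (scale_chart g' (chart_at (foot q)) q) q)
    (cmap (chart_at (foot q)) \o (@foot _ _ M c) \o cinv (scale_chart g'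
      (chart_at (foot q)) q))
    (fun w : 'rV[R]_(1 + n) => rsubmx w).
  apply: is_diff_near_eq (is_diff_rV_linear _ (@linear_rsubmx R 1 n)).
  apply: filterS (near_scale_chart g' a d) => w [w0 [x [dx _] xE]].
  have [f _] := @scale_chart_cinvP g' (chart_at (foot q)) q cg' w w0.
  have iw : chart_img (chart_at (foot q)) (rsubmx w) by exists x.
  have [_ k] := chart_cinvP HM a iw.
  by rewrite -[RHS]/(cmap (chart_at (foot q)) (foot (cinv _ w))) f k.
by case: H => _ /(congr1 (@^~ xi)).
Qed.

Lemma is_diff_unique (V W : normedModType R) (x : V) (f d1 d2 : V -> W) :
  is_diff x f d1 -> is_diff x f d2 -> d1 = d2.
Proof. by move=> [_ <-] [_ <-]. Qed.

(** The t-component t exp(u) also varies along M, but its derivative is recorded only on vertical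
    vectors: that is enough for injectivity, and the pullback does not see it. *)
Lemma tangent_embeddingP (q : Q) :
  [/\ forall xi, rcoord (tangent_map iota q xi) = 0,
      forall xi, xcoord (tangent_map iota q xi) = rsubmx xi &
      exists2 C : R, C != 0 & forall xi, rsubmx xi = 0 ->
        tcoord (tangent_map iota q xi) = lsubmx xi 0 0 * C].
Proof.
have [a d] := manifold_chart_atP HM (foot q).
have [g' cg' qE] := scale_chart_atP q.
have [u us g'E] := metrics_conformal HM cg cg'.
set phi := chart_at (foot q) in a d qE.
pose sc := scale_chart g' phi q; pose y := cmap sc q.
pose F := cmap (chart_at (iota q)) \o iota \o cinv sc.
have FD : is_diff y F (tangent_map iota q).
  rewrite /tangent_map qE; apply: differentiableP.
  have [+ _] := embedding_chart_Ck q cg' a 1 (iota q).1 (iota q).2.1 a.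
  by move/(_ y); apply; exact: nbhs_singleton (near_scale_chart g' a d).
have FE w : F w = row_mx (val (ray_coord g (cinv sc w)))%:M
    (row_mx 0%:M (cmap phi (foot (cinv sc w)))) by [].
have tF : \forall w \near y,
    tcoord (F w) = lsubmx (w : 'rV[R]_(1 + n)) 0 0 * expR (u (cinv phi (rsubmx
      w))).
  apply: filterS (near_scale_chart g' a d) => w [w0 _].
  have [f r] := @scale_chart_cinvP g' phi q cg' w w0.
  by rewrite FE tcoord_row (ray_coord_conformal HM n_gt0 _ cg cg' g'E) f r.
have xF : \forall w \near y, (rsubmx (w : 'rV[R]_(1 + n)) : 'rV[R]_n) =
  xcoord (F w).
  apply: filterS (near_scale_chart g' a d) => w [w0 [x [dx _] xE]].
  have [f _] := @scale_chart_cinvP g' phi q cg' w w0.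
  have iw : chart_img phi (rsubmx w) by exists x.
  have [_ k] := chart_cinvP HM a iw.
  by rewrite FE xcoord_row f k.
have coordFD (W : normedModType R) (L : 'rV[R]_(1 + (1 + n)) -> W) : linear L ->
    is_diff y (L \o F) (L \o tangent_map iota q).
  by move=> linL; have LD := is_diff_rV_linear (F y) linL; apply: is_diff_comp.
split.
- move=> xi; have D1 := coordFD _ _ (@linear_rcoord R n).
  have D2 : is_diff y (@rcoord R n \o F) (cst 0).
    have -> : @rcoord R n \o F = cst 0.
      by apply/funext => w; rewrite /comp FE rcoord_row.
    exact: is_diff_cst.
  by have /(congr1 (@^~ xi)) := is_diff_unique D1 D2.
- move=> xi; have D1 := coordFD _ _ (@linear_xcoord R n).
  have D2 := is_diff_near_eq xF (is_diff_rV_linear y (@linear_rsubmx R 1 n)).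
  by have /(congr1 (@^~ xi)) := is_diff_unique D1 D2.
- exists (expR (u (cinv phi (rsubmx y)))); first by rewrite gt_eqF // expR_gt0.
  move=> xi xi0; have D1 := coordFD _ _ (@linear_tcoord R n).
  rewrite -[LHS]/((@tcoord R n \o tangent_map iota q) xi) -(is_diff_derive xi
    D1).
  rewrite (near_eq_derive xi tF) derive_line.
  set C := expR _.
  (* Moving along a vertical [xi] fixes the point of M, so the exponential is constant and the
     function is affine in [h]; the quadratic term is zero. *)
  have -> : (fun h : R => lsubmx (h *: xi + y) 0 0 *
      expR (u (cinv phi (rsubmx (h *: xi + y))))) =
      fun h => lsubmx y 0 0 * C + (lsubmx xi 0 0 * C) * h + 0 * h ^+ 2.
    apply/funext => h; rewrite !linearD !linearZ /= xi0 scaler0 add0r -/C !mxE.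
    by ring.
  exact: derive_quadratic.
Qed.

(** A vector in the kernel is vertical by its x-component, and then its t-component is a nonzero
    multiple of the vertical coordinate. *)
Lemma tangent_embedding_injective (q : Q) : injective (tangent_map iota q).
Proof.
have [_ xT [C C0 tT]] := tangent_embeddingP q.
move=> v w vw; apply/eqP; rewrite -subr_eq0; apply/eqP.
have T0 : tangent_map iota q (v - w) =
  0 by rewrite /tangent_map linearB /= -/(tangent_map iota q v) vw subrr.
have r0 : rsubmx (v - w) = 0 by rewrite -xT T0 /xcoord !linear0.
have := tT _ r0; rewrite T0 {1}/tcoord linear0 mxE => /esym/eqP.
rewrite mulf_eq0 (negbTE C0) orbF => /eqP l0.
rewrite -[LHS]hsubmxK r0 (_ : lsubmx _ = 0) ?row_mx0 //.
by apply/rowP => i; rewrite !ord1 l0 mxE.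
Qed.

Lemma embedding_smooth_embedding : smooth_embedding iota.
Proof.
split.
- exact: embedding_smooth.
- exact: tangent_embedding_injective.
- exact: embedding_injective.
- exact: embedding_initial.
Qed.

Hypothesis adm : is_admissible c alpha.

(** On the image both rho and drho vanish, hence so does rho dt + t drho, and dt is multiplied by
    zero. What remains is t^2 g on the projections to M, which is [sform q]. *)
Lemma embedding_pullback (q : Q) xi eta :
  gA (iota q) (tangent_map iota q xi) (tangent_map iota q eta) =
  sform q (@tangent_map _ _ _ Q M (@foot _ _ M c) q xi)
          (@tangent_map _ _ _ Q M (@foot _ _ M c) q eta).
Proof.
rewrite ambient_metricE // !tangent_foot (ray_coordP q cg).
have [rT xT _] := tangent_embeddingP q.
rewrite /lorentz_form !rT !xT.
have -> : rA (iota q) = 0 by [].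
have [_ _ -> _] := adm.
by rewrite !mul0r !mulr0 !addr0 mul0r mulr0 !add0r.
Qed.

End Embedding.

Theorem proposition3p3 (R : realType) (n : nat) (M : charted_space R n)
    (c : conformal_structure M) (g : tensor02 M) (alpha : R -> endo_field M)
    (delta : R) (delta_gt0 : 0 < delta) :
  is_manifold M -> (2 <= n)%N ->
  metrics c g ->
  is_admissible c alpha ->
  (forall rho : R, `|rho| < delta -> nonsingular (alpha rho)) ->
  is_preambient_space c (ambient_metric delta g alpha)
    (ambient_act delta) (ambient_embedding delta_gt0 g).
Proof.
move=> HM n_ge2 cg adm nsing; have n_gt0 : (0 < n)%N := ltnW n_ge2.
split.
- split; [exact: ambient_manifold|exact: (@ambient_lorentzian _ _ _ c)].
- exact: ambient_free_action.
- split; [exact: embedding_smooth_embedding|exact: embedding_equivariant].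
- by move=> p u v; exact: (@ambient_lie_derivative _ _ _ c).
- by move=> q xi eta; exact: embedding_pullback.
Qed.
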